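(* For every integer $\Delta\ge 0$ there exist constants $c,C>0$ and $n_0$, depending only on $\Delta$, such that the following holds. Let $G=(V,E)$ be any vertex-transitive graph with $n=|V|\ge n_0$ vertices and maximum degree at most $\Delta$. Then the cover time $T_{\mathrm{cov}}$ of the local search allocation on $G$ satisfies $$\mathbf{Pr}\left[\,c\,R_2(G)\,n\le T_{\mathrm{cov}}\le C\,R_2(G)\,n\,\right]\ge 1-n^{-1},$$ i.e. with probability at least $1-n^{-1}$ the cover time is $\Theta(R_2 n)$.
   Context: Graphs are finite and undirected, not necessarily connected. $d_G(u,v)$ is the graph distance ($\infty$ if $u,v$ lie in different components) and $B_u^r=\{v\in V: d_G(u,v)\le r\}$. With $\mathbb{N}=\{1,2,\dots\}$ and $\log$ the natural logarithm, define $$R_2(G)=\min\{r\in\mathbb{N}: r\,|B_u^r|\ge \log n\ \text{for all } u\in V\}.$$ Local search allocation on $G$: initially all vertices have load $0$. Balls $1,2,\dots$ arrive one at a time. Ball $i$ is born at a vertex $U_i$ (its birthplace) chosen independently and uniformly at random from $V$. Starting at its birthplace, in each step the ball moves to a neighbour of its current vertex having the smallest load among all neighbours, provided that this load is strictly smaller than the load of the current vertex; ties between smallest-load neighbours are broken independently and uniformly at random. The ball stops at the first vertex visited that has no neighbour of strictly smaller load, and it is allocated there, increasing that vertex's load by $1$. Then the next ball arrives. $X_v^{(m)}$ denotes the load of $v$ after $m$ balls have been allocated. The cover time is $T_{\mathrm{cov}}=\min\{m\ge 0: X_v^{(m)}\ge 1\text{ for all }v\in V\}$. *)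

(* Defs.v *)
From HB Require Import structures.
From mathcomp Require Import all_boot all_order all_algebra all_fingroup.
From mathcomp Require Import all_classical all_reals all_analysis.
Import Order.TTheory GRing.Theory Num.Theory.

Set Implicit Arguments.
Unset Strict Implicit.
Unset Printing Implicit Defensive.

Local Open Scope classical_set_scope.
Local Open Scope ring_scope.

(* The minimum of a set of natural numbers, with value +oo on the empty set. *)
Definition nat_inf (R : realType) (A : set nat) : \bar R :=
  ereal_inf [set m%:R%:E | m in A].

Section Graphs.
Variables (R : realType) (V : finType) (e : rel V).

Definition simple_graph : Prop := symmetric e /\ irreflexive e.

Definition vertex_transitive : Prop :=
  forall u v : V, exists f : {perm V},
    (forall x y, e (f x) (f y) = e x y) /\ f u = v.

Definition neighbours (u : V) : {set V} := [set v | e u v]%SET.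

Definition max_degree : nat := \max_(u : V) #|neighbours u|.

Definition gdist (u v : V) : \bar R :=
  nat_inf R [set size p | p in [set p : seq V | path e u p /\ last u p = v]].

Definition gball (u : V) (r : nat) : {set V} :=
  [set v | (gdist u v <= r%:R%:E)%E]%SET.

Definition R2_pred (r : nat) : bool :=
  (0 < r)%N && [forall u : V, ln (#|V|%:R : R) <= r%:R * #|gball u r|%:R].

Lemma R2_pred_ex : exists r, R2_pred r.
Proof.
exists (Num.bound (ln (#|V|%:R : R))).+1; apply/andP; split => //.
apply/forallP => u; set r := (Num.bound _).+1.
have u_ball : u \in gball u r.
  rewrite inE; apply: (@le_trans _ _ (0%:R%:E : \bar R)%E).
    by apply: ereal_inf_lbound; exists 0%N => //; exists [::].
  by rewrite lee_fin ler_nat.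
have card_gt0 : (1 : R) <= #|gball u r|%:R.
  by rewrite (ler_nat _ 1) card_gt0; apply/set0Pn; exists u.
apply: (@le_trans _ _ (r%:R : R)); last by rewrite ler_peMr.
apply: (le_trans (ler_norm _)); apply: ltW.
apply: (lt_le_trans (archi_boundP (normr_ge0 _))).
by rewrite ler_nat /r /Num.bound normr_id.
Qed.

Definition R2 : nat := ex_minn R2_pred_ex.

End Graphs.

(* The trajectory of a ball: its birthplace and the list of the vertices it   *)
(* visits afterwards, in order.                                               *)
Definition trajectory (V : finType) : Type := (V * seq V)%type.

Definition birthplace (V : finType) (p : trajectory V) : V := p.1.

Definition final_vertex (V : finType) (p : trajectory V) : V := last (birthplace p) p.2.

(* h i is the trajectory of ball i + 1, so load h m v is the load of v after  *)
(* the first m balls have been allocated.                                     *)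
Definition load (V : finType) (h : nat -> trajectory V) (m : nat) (v : V) : nat :=
  \sum_(i < m) (final_vertex (h i) == v).

Section LocalSearch.
Variables (R : realType) (V : finType) (e : rel V).

Definition min_neighbours (x : V -> nat) (u : V) : {set V} :=
  [set w in neighbours e u | [forall z in neighbours e u, (x w <= x z)%N]]%SET.

Definition local_min (x : V -> nat) (u : V) : bool :=
  [forall w in neighbours e u, ~~ (x w < x u)%N].

(* Conditional probability, given the loads x, that a ball currently at u     *)
(* visits exactly the vertices of p from now on and then stops.               *)
Fixpoint walk_prob (x : V -> nat) (u : V) (p : seq V) : R :=
  match p with
  | [::] => if local_min x u then 1 else 0
  | w :: p' =>
      if ~~ local_min x u && (w \in min_neighbours x u)
      then #|min_neighbours x u|%:R^-1 * walk_prob x w p' else 0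
  end.

Definition trajectory_prob (x : V -> nat) (p : trajectory V) : R :=
  #|V|%:R^-1 * walk_prob x (birthplace p) p.2.

Variables (d : measure_display) (T : measurableType d) (P : probability T R).

(* Conditionally on the trajectories of the first m balls, the next one is    *)
(* born uniformly and follows the local search with uniform tie-breaking.     *)
(* This determines the joint law of all trajectories, in which birthplaces    *)
(* are independent and uniform and all ties are broken independently.         *)
Definition local_search_allocation (B : nat -> T -> trajectory V) : Prop :=
  (forall (i : nat) (p : trajectory V), measurable [set w | B i w = p]) /\
  (forall (m : nat) (h : nat -> trajectory V),
     P [set w | forall i, (i < m.+1)%N -> B i w = h i] =
     (P [set w | forall i, (i < m)%N -> B i w = h i]
      * (trajectory_prob (load h m) (h m))%:E)%E).

Definition cover_time (B : nat -> T -> trajectory V) (w : T) : \bar R :=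
  nat_inf R [set m | forall v : V, (1 <= load (B ^~ w) m v)%N].

End LocalSearch.

(* Main.v *)
Require Import Defs.
From HB Require Import structures.
From mathcomp Require Import all_boot all_order all_algebra all_fingroup.
From mathcomp Require Import all_classical all_reals all_analysis.
From mathcomp Require Import zify ring lra.
Import Order.TTheory GRing.Theory Num.Theory.

Set Implicit Arguments.
Unset Strict Implicit.
Unset Printing Implicit Defensive.

Local Open Scope classical_set_scope.
Local Open Scope ring_scope.

(* Two exponential potentials drive the proof. A ball moves to strictly        *)
(* smaller loads, so along its walk the load drops by at least 1 per step      *)
(* while the distance to a fixed vertex v changes by at most 1. A potential    *)
(* whose increment (or decrement) at a vertex w is monotone in load(w) +       *)
(* dist(v, w), resp. 2 load(w) - dist(v, w), can therefore only be helped by   *)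
(* the moves, and its drift is computed as if balls stayed at their            *)
(* birthplaces.                                                                *)
(*                                                                             *)
(* Upper bound: the product over w of 1 + a_t Q^-(dist(v, w) + load(w)), with  *)
(* a_t growing by the factor 1 + 1/(2n) at each step, is a supermartingale. If *)
(* v is uncovered, loads are at most the distance to v, and each of the        *)
(* vertices of the ball of radius R_2 contributes a factor exp(3 R_2); the     *)
(* product is then at least exp(3 R_2 |ball|) >= n^3.                          *)
(*                                                                             *)
(* Lower bound: v stays uncovered if no ball is born within distance R_2 and   *)
(* the sum Phi_v of Q^(2 load(w) - dist(v, w)) over w stays below Q^R_2. The   *)
(* sum over v of p^(m - t) [no birth near v] (1 - a^(m - t) Phi_v / Q^R_2) is  *)
(* a submartingale starting from at least n^(9/10) / 2, with increments        *)
(* O(n^(1/5)) as long as the maximal load is a small multiple of log n, so     *)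
(* with overwhelming probability it is still positive at time m.               *)

(** * Balls and distances *)

(** Why [R2] is the right scale. Loads are 1-Lipschitz along edges ([load_lipschitz]), so if v is
    empty then its whole ball of radius [R2] carries loads at most [R2]. After a large multiple of
    [R2] n balls this is a deficit of order [R2] |ball| >= log n, whose probability is polynomially
    small. Conversely, minimality of [R2], bounded degree and transitivity give [R2] |ball| = O(log
    n) ([R2_card_gball]). After a small multiple of [R2] n balls many vertices therefore still have
    no birth within distance [R2], and a ball can reach such a vertex only by descending from a load
    larger than [R2], which is rare.

    Both halves rest on [supermartingale_bound], which turns a potential on histories into a bound
    on the probability of an event. The first half is [local_search_uncovered_le] for one vertex,
    followed by the union bound [local_search_some_uncovered_le]. The second is
    [local_search_cover_le], an Azuma-type estimate valid while loads stay at most L, combined in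
    [local_search_not_covered] with [local_search_max_load_le], which controls larger loads. Each
    half fails with probability at most 1/(2n). *)

Lemma nat_inf_le (R : realType) (A : set nat) (r : nat) :
  (nat_inf R A <= r%:R%:E)%E <-> exists2 k, A k & (k <= r)%N.
Proof.
split=> [Ar|[k Ak kr]]; last first.
  apply: (@le_trans _ _ (k%:R%:E : \bar R)); last by rewrite lee_fin ler_nat.
  by apply: ereal_inf_lbound; exists k.
apply: contrapT => noA.
suff : ((r.+1%:R%:E : \bar R) <= nat_inf R A)%E.
  by move=> /le_trans/(_ Ar); rewrite lee_fin ler_nat ltnn.
apply: le_ereal_inf_tmp => _ [k Ak <-]; rewrite lee_fin ler_nat ltnNge.
by apply/negP => kr; apply: noA; exists k.
Qed.

Section Balls.
Variables (R : realType) (V : finType) (e : rel V).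
Local Notation gball := (gball R e).

Lemma gballP u r w :
  reflect (exists p, [/\ path e u p, last u p = w & (size p <= r)%N])
          (w \in gball u r).
Proof.
rewrite inE; apply: (iffP idP) => [/nat_inf_le [k [p [ep pw] <-] kr]|].
  by exists p.
by case=> p [ep pw pr]; apply/nat_inf_le; exists (size p) => //; exists p.
Qed.

Lemma gball_refl u r : u \in gball u r.
Proof. by apply/gballP; exists [::]. Qed.

Lemma gballSl u w z r : w \in gball u r -> e w z -> z \in gball u r.+1.
Proof.
move=> /gballP[p [ep pw pr]] wz; apply/gballP; exists (rcons p z).
by rewrite rcons_path last_rcons size_rcons ep pw wz ltnS.
Qed.

Lemma gball_sym u w r : symmetric e -> w \in gball u r -> u \in gball w r.
Proof.
move=> syme /gballP[p [ep <- pr]]; apply/gballP; exists (rev (belast u p)); split.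
- by rewrite rev_path; rewrite (eq_path (e' := e)) // => x y; rewrite syme.
- case: p {ep pr} => [|x p] //=.
  by rewrite rev_cons last_rcons.
- by rewrite size_rev size_belast.
Qed.

Variable Delta : nat.
Hypothesis degD : (max_degree e <= Delta)%N.

Lemma card_neighbours u : (#|neighbours e u| <= Delta)%N.
Proof. by apply: leq_trans degD; exact: (leq_bigmax (F := fun u => #|neighbours e u|)). Qed.

Lemma card_gballS u r : (#|gball u r.+1| <= Delta.+1 * #|gball u r|)%N.
Proof.
have sub : gball u r.+1 \subset (\bigcup_(w in gball u r) (w |: neighbours e w))%SET.
  apply/fintype.subsetP => z /gballP[p [ep pz pr]].
  case: (lastP p) ep pz pr => [|q y] ep pz pr.
    apply/bigcupP; exists u; first exact: gball_refl.
    by rewrite -pz finset.in_setU1 eqxx.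
  move: ep pz pr; rewrite rcons_path last_rcons size_rcons ltnS => /andP[eq qy] <- qr.
  apply/bigcupP; exists (last u q); first by apply/gballP; exists q.
  by rewrite finset.in_setU1 inE qy orbT.
apply: leq_trans (subset_leq_card sub) _.
suff UB (A : {set V}) :
    (#|(\bigcup_(w in A) (w |: neighbours e w))%SET| <= \sum_(w in A) Delta.+1)%N.
  by apply: leq_trans (UB _) _; rewrite sum_nat_const mulnC.
elim/big_rec2: _ => [|w B b _ IH]; first by rewrite cards0.
apply: leq_trans (leq_card_setU _ _) _; rewrite leq_add //.
by rewrite cardsU1 -add1n leq_add ?leq_b1 ?card_neighbours.
Qed.

Lemma card_gball u r : (#|gball u r| <= Delta.+1 ^ r)%N.
Proof.
elim: r => [|r IH]; last first.
  by rewrite expnS; apply: leq_trans (card_gballS _ _) _; rewrite leq_mul2l IH orbT.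
rewrite expn0 -(cards1 u); apply/subset_leq_card/fintype.subsetP => w.
by case/gballP => -[|y p] [_ <-]; rewrite //= inE.
Qed.

Lemma vertex_transitive_card_gball u v r :
  vertex_transitive e -> #|gball u r| = #|gball v r|.
Proof.
move=> vt; suff le x y : (#|gball x r| <= #|gball y r|)%N.
  by apply/eqP; rewrite eqn_leq !le.
have [f [fe fx]] := vt x y; rewrite -(card_imset _ (@perm_inj _ f)).
apply/subset_leq_card/fintype.subsetP => _ /imsetP[w /gballP[p [ep pw pr]] ->].
apply/gballP; exists (map f p); rewrite size_map -fx last_map pw; split => //.
by rewrite path_map (eq_path (e' := e)) // => a b; rewrite /= fe.
Qed.

(* The distance in the graph, truncated at #|V|; the truncation keeps it       *)
(* finite and 1-Lipschitz across components.                                   *)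
Definition dist (u w : V) : nat :=
  (\sum_(0 <= r < #|V|) (w \notin gball u r))%N.

Lemma gball_mono u r s : (r <= s)%N -> gball u r \subset gball u s.
Proof.
move=> rs; apply/fintype.subsetP => w /gballP[p [ep pw pr]].
by apply/gballP; exists p; rewrite (leq_trans pr).
Qed.

Lemma dist_leV u w : (dist u w <= #|V|)%N.
Proof.
rewrite -[leqRHS]subn0 -[leqRHS]muln1 -sum_nat_const_nat.
by apply: leq_sum => i _; exact: leq_b1.
Qed.

Lemma dist_le u w r : w \in gball u r -> (dist u w <= r)%N.
Proof.
move=> wr; rewrite /dist; elim: #|V| => [|n IH]; first by rewrite big_geq.
rewrite big_nat_recr //=; have [nr|rn] := ltnP n r.
  rewrite -addn1 in nr; apply: leq_trans nr; rewrite leq_add ?leq_b1 //.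
  rewrite -[leqRHS]subn0 -[leqRHS]muln1 -sum_nat_const_nat.
  by apply: leq_sum => i _; exact: leq_b1.
by rewrite (fintype.subsetP (gball_mono u rn)) // addn0.
Qed.

(** [dist] counts the radii whose ball misses w. Balls are nested, so missing the ball of radius
    [dist u w] would mean missing all smaller ones too, one radius too many. *)
Lemma gball_dist u w : (dist u w < #|V|)%N -> w \in gball u (dist u w).
Proof.
move=> dV; apply: contraT => wd.
suff : (dist u w < dist u w)%N by rewrite ltnn.
rewrite {2}/dist (big_cat_nat (n := (dist u w).+1)) //=.
apply: leq_trans (leq_addr _ _).
rewrite -[leqLHS]subn0 -[leqLHS]muln1 -sum_nat_const_nat.
rewrite [leqLHS]big_nat_cond [leqRHS]big_nat_cond.
apply: leq_sum => i; rewrite andbT ltnS /= => id.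
rewrite lt0b; apply: contra wd; exact/fintype.subsetP/gball_mono.
Qed.

Lemma distS u w z : e w z -> (dist u z <= (dist u w).+1)%N.
Proof.
move=> wz; have [dV|Vd] := ltnP (dist u w) #|V|.
  exact/dist_le/(gballSl _ wz)/gball_dist.
by apply: leq_trans (dist_leV _ _) _; rewrite leqW.
Qed.

Lemma dist_sym u w : symmetric e -> dist u w = dist w u.
Proof.
move=> syme; apply: eq_bigr => r _; congr (nat_of_bool (~~ _)).
by apply/idP/idP; exact: gball_sym.
Qed.

(** Balls of radius r have at most (Delta + 1)^r vertices, so the sum over r is dominated by a
    geometric series of ratio 1/2, of total at most 2. The vertices at the truncated distance n add
    at most n Q^-n <= 1. *)
Lemma sum_dist_weight (Q : R) u : 2 * Delta.+1%:R <= Q ->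
  \sum_w Q ^- dist u w <= 3.
Proof.
move=> HQ; have D1 : 1 <= Delta.+1%:R :> R by rewrite ler1n.
have Q0 : 0 < Q by lra.
apply: (@le_trans _ _ (\sum_w (\sum_(0 <= r < #|V|)
    (if w \in gball u r then Q ^- r else 0) + Q ^- #|V|))).
  apply: ler_sum => w _; have [dV|Vd] := ltnP (dist u w) #|V|.
    rewrite (bigD1_seq (dist u w)) ?mem_index_iota ?iota_uniq //=.
    rewrite gball_dist // -addrA lerDl addr_ge0 //; last by rewrite invr_ge0 exprn_ge0 ?ltW.
    by apply: sumr_ge0 => i _; case: ifP => // _; rewrite invr_ge0 exprn_ge0 ?ltW.
  have -> : dist u w = #|V| by apply/eqP; rewrite eqn_leq dist_leV.
  rewrite lerDr; apply: sumr_ge0 => i _; case: ifP => // _.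
  by rewrite invr_ge0 exprn_ge0 ?ltW.
rewrite big_split /= exchange_big /= sumr_const.
have -> : 3 = 2 + 1 :> R by lra.
apply: lerD; last first.
  rewrite -(mulr_natl _ #|V|) ler_pdivrMr ?exprn_gt0 // mul1r.
  apply: (@le_trans _ _ (2 ^+ #|V|)); last by rewrite lerXn2r ?nnegrE; lra.
  by rewrite -natrX ler_nat ltnW // ltn_expl.
apply: (@le_trans _ _ (\sum_(0 <= r < #|V|) 2 ^- r)).
  apply: ler_sum => r _; rewrite -big_mkcond /= sumr_const -(mulr_natl _ #|_|).
  rewrite ler_pdivrMr ?exprn_gt0 //.
  apply: (@le_trans _ _ (Delta.+1%:R ^+ r)).
    by rewrite -natrX ler_nat card_gball.
  rewrite -exprVn -exprMn lerXn2r ?nnegrE //; lra.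
elim: #|V| => [|k IH]; first by rewrite big_geq.
suff : \sum_(0 <= r < k.+1) 2 ^- r = 2 - 2 ^- k :> R.
  by move=> ->; rewrite gerBl invr_ge0 exprn_ge0.
elim: k {IH} => [|k IH]; first by rewrite big_nat1 expr0 invr1; lra.
by rewrite big_nat_recr //= IH exprS invfM; lra.
Qed.

End Balls.

(** * Walks and loads *)

Section Walks.
Variables (R : realType) (V : finType) (e : rel V).
Local Notation walk_prob := (@walk_prob R V e).
Implicit Types (x : V -> nat) (u : V) (p : seq V).

Definition descent x : rel V := [rel a b | e a b && (x b < x a)%N].

Lemma min_neighbours_lt x u w :
  ~~ local_min e x u -> w \in min_neighbours e x u -> e u w && (x w < x u)%N.
Proof.
case/forall_inPn => z uz; rewrite negbK => zu; rewrite inE => /andP[uw /forall_inP wmin].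
by move: uw; rewrite inE => ->; exact: leq_ltn_trans (wmin _ uz) zu.
Qed.

Lemma card_min_neighbours_gt0 x u :
  ~~ local_min e x u -> (0 < #|min_neighbours e x u|)%N.
Proof.
case/forall_inPn => z uz _; apply/card_gt0P.
exists [arg min_(w < z in neighbours e u) x w]; case: arg_minnP => // w uw wmin.
by rewrite inE uw; apply/forall_inP.
Qed.

Lemma walk_prob_ge0 x u p : 0 <= walk_prob x u p.
Proof.
elim: p u => [|w p IH] u /=; first by case: ifP.
by case: ifP => // _; rewrite mulr_ge0 ?invr_ge0.
Qed.

Lemma walk_prob_descent x u p : walk_prob x u p != 0 ->
  path (descent x) u p /\ local_min e x (last u p).
Proof.
elim: p u => [|w p IH] u /=; first by case: ifP; rewrite ?eqxx.
case: ifP => [/andP[um wu]|]; last by rewrite eqxx.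
rewrite mulf_eq0 negb_or => /andP[_ /IH[-> ->]]; split => //.
by rewrite andbT; exact: min_neighbours_lt.
Qed.

Lemma descent_size x u p : path (descent x) u p -> (x (last u p) + size p <= x u)%N.
Proof.
elim: p u => [|w p IH] u /=; first by rewrite addn0.
by case/andP => /andP[_ wu] /IH; lia.
Qed.

Lemma descent_path x u p : path (descent x) u p -> path e u p.
Proof. by apply: sub_path => a b /andP[]. Qed.

Lemma descent_dist x u p v : path (descent x) u p ->
  (dist R e v (last u p) <= dist R e v u + size p)%N.
Proof.
elim: p u => [|w p IH] u /=; first by rewrite addn0.
case/andP => /andP[uw _] /IH; have := @distS R _ _ v _ _ uw; lia.
Qed.

Fixpoint words_upto k : seq (seq V) :=
  if k is k'.+1 then [::] :: [seq w :: p | w <- enum V, p <- words_upto k'] else [:: [::]].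

Lemma words_upto_uniq k : uniq (words_upto k).
Proof.
elim: k => //= k IH; apply/andP; split.
  by apply/negP => /allpairsP[[w p] []].
by apply: allpairs_uniq => //; [exact: enum_uniq | case=> [a b] [c d] _ _ [-> ->]].
Qed.

(** Each move lowers the load by at least 1, so a walk from load at most k makes at most k moves and
    the words of length at most k carry all of its probability. *)
Lemma walk_prob_sum x u k : (x u <= k)%N -> \sum_(p <- words_upto k) walk_prob x u p = 1.
Proof.
elim: k u => [|k IH] u /= uk.
  rewrite big_seq1 /=; case: ifPn => // /forall_inPn[z _]; lia.
rewrite big_cons big_allpairs_dep /= big_enum /=.
case: ifPn => [um|num] /=.
  by rewrite big1 ?addr0 // => w _; rewrite big1.
rewrite add0r (bigID (mem (min_neighbours e x u))) /= [X in _ + X]big1 ?addr0; last first.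
  by move=> w /negbTE wu; rewrite big1 // => p _; rewrite wu.
under eq_bigr => w wu.
  under eq_bigr do rewrite wu.
  rewrite -mulr_sumr IH ?mulr1; last first.
    by have /andP[_] := min_neighbours_lt num wu; lia.
  over.
rewrite sumr_const -[LHS]mulr_natr mulVf //.
by rewrite pnatr_eq0 -lt0n card_min_neighbours_gt0.
Qed.

End Walks.

Section Loads.
Variables (R : realType) (V : finType) (e : rel V).
Implicit Types (h : nat -> trajectory V) (t : nat) (p : trajectory V).

(* h has positive probability as the history of the first t balls. *)
Definition valid h t : Prop :=
  forall i, (i < t)%N -> walk_prob R e (load h i) (birthplace (h i)) (h i).2 != 0.

Definition upd h t p : nat -> trajectory V := fun i => if i == t then p else h i.

Lemma eq_load h h' t : (forall i, (i < t)%N -> h i = h' i) -> load h t = load h' t.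
Proof. by move=> hh; apply/funext => v; apply: eq_bigr => i _; rewrite hh. Qed.

Lemma loadS h t v : load h t.+1 v = (load h t v + (final_vertex (h t) == v))%N.
Proof. by rewrite /load big_ord_recr. Qed.

Lemma load0 h v : load h 0 v = 0%N.
Proof. by rewrite /load big_ord0. Qed.

Lemma load_mono h s t v : (s <= t)%N -> (load h s v <= load h t v)%N.
Proof.
elim: t => [|t IH]; first by rewrite leqn0 => /eqP->.
by rewrite leq_eqVlt => /predU1P[->//|/IH]; rewrite loadS; lia.
Qed.

Lemma load_le h t v : (load h t v <= t)%N.
Proof. by elim: t => [|t IH]; rewrite ?load0 // loadS; case: eqP; lia. Qed.

Lemma upd_before h t p i : (i < t)%N -> upd h t p i = h i.
Proof. by rewrite /upd; case: eqP => // ->; rewrite ltnn. Qed.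

Lemma load_upd h t p : load (upd h t p) t = load h t.
Proof. by apply: eq_load => i; exact: upd_before. Qed.

Lemma load_updS h t p v :
  load (upd h t p) t.+1 v = (load h t v + (final_vertex p == v))%N.
Proof. by rewrite loadS load_upd /upd eqxx. Qed.

Lemma valid_upd h t p : valid h t ->
  walk_prob R e (load h t) (birthplace p) p.2 != 0 -> valid (upd h t p) t.+1.
Proof.
move=> vh vp i; rewrite ltnS leq_eqVlt => /predU1P[->|it].
  by rewrite load_upd /upd eqxx.
rewrite upd_before // (@eq_load _ h); first exact: vh.
by move=> j ji; rewrite upd_before // (ltn_trans ji).
Qed.

Lemma validW h t : valid h t.+1 -> valid h t.
Proof. by move=> vh i it; apply: vh; rewrite ltnW. Qed.

(** A ball stops at a local minimum, so its increment leaves that vertex at most one above any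
    neighbour. *)
Lemma load_lipschitz h t u w : symmetric e -> valid h t -> e u w ->
  (load h t u <= (load h t w).+1)%N.
Proof.
move=> syme; elim: t u w => [|t IH] u w vh uw; first by rewrite !load0.
have := IH _ _ (validW vh) uw; rewrite !loadS.
have [_ lm] := walk_prob_descent (vh t (ltnSn t)).
case: eqP => [fu|_]; last by lia.
move/forall_inP: lm => /(_ w); rewrite inE -/(final_vertex (h t)) fu uw => /(_ isT).
lia.
Qed.

Lemma load_ball h t u w r : symmetric e -> valid h t ->
  w \in gball R e u r -> (load h t w <= load h t u + r)%N.
Proof.
move=> syme vh /gballP[p [ep <- pr]].
suff : (load h t (last u p) <= load h t u + size p)%N by lia.
elim: p u ep {pr} => [|z p IH] u /=; first by rewrite addn0.
case/andP => uz /IH; rewrite syme in uz; have := load_lipschitz syme vh uz; lia.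
Qed.

End Loads.

(** * Supermartingale bound *)

Section Supermartingale.
Variables (R : realType) (V : finType) (e : rel V).
Variables (d : measure_display) (T : measurableType d) (P : probability T R).
Variables (B : nat -> T -> trajectory V).
Hypothesis lsa : local_search_allocation e P B.
Implicit Types (h : nat -> trajectory V) (t : nat) (p : trajectory V).

Definition determined m (A : set (nat -> trajectory V)) : Prop :=
  forall h h', (forall i, (i < m)%N -> h i = h' i) -> A h -> A h'.

(** There are countably many trajectories, so conditioning on the value of the last relevant ball
    gives a countable union of events decided one ball earlier. *)
Lemma measurable_determined m (A : set (nat -> trajectory V)) :
  determined m A -> measurable [set w | A (B ^~ w)].
Proof.
elim: m A => [|m IH] A detA.
  have [[w Aw]|noA] := pselect (exists w, A (B ^~ w)).
    rewrite (_ : [set _ | _] = setT); first exact: measurableT.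
    by apply/seteqP; split=> // w' _; apply: detA Aw.
  rewrite (_ : [set _ | _] = set0); first exact: measurable0.
  by apply/seteqP; split=> // w Aw; apply: noA; exists w.
have -> : [set w | A (B ^~ w)] =
    \bigcup_p ([set w | B m w = p] `&` [set w | A (upd (B ^~ w) m p)]).
  apply/seteqP; split=> [w Aw|w [p _ [/= Bp Aw]]].
    exists (B m w) => //; split => //=; apply: detA Aw => i _.
    by rewrite /upd; case: eqP => [->|].
  by apply: detA Aw => i _; rewrite /upd; case: eqP => [->|].
apply: countable_bigcupT_measurable => [|p]; first exact: countableP.
apply: measurableI; first exact: lsa.1.
apply: (IH [set h | A (upd h m p)]) => h h' hh'; apply: detA => i im.
rewrite /upd; case: eqP => // im'; apply: hh'; lia.
Qed.

Definition cyl t h : set T := [set w | forall i, (i < t)%N -> B i w = h i].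

Lemma determined_cyl t h : determined t [set h' | forall i, (i < t)%N -> h' i = h i].
Proof. by move=> h1 h2 h12 /= h1h i it; rewrite -h12 ?h1h. Qed.

Lemma measurable_cyl t h : measurable (cyl t h).
Proof. exact: (measurable_determined (@determined_cyl t h)). Qed.

Definition pr (A : set T) : R := fine (P A).

Lemma prE A : measurable A -> P A = (pr A)%:E.
Proof. by move=> mA; rewrite fineK // fin_num_measure. Qed.

Lemma pr_ge0 A : 0 <= pr A.
Proof. by rewrite fine_ge0. Qed.

Lemma pr_le A1 A2 : measurable A1 -> measurable A2 -> A1 `<=` A2 -> pr A1 <= pr A2.
Proof. by move=> mA1 mA2 A12; rewrite -lee_fin -!prE // le_measure // inE. Qed.

Lemma prU A1 A2 : measurable A1 -> measurable A2 -> A1 `&` A2 = set0 ->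
  pr (A1 `|` A2) = pr A1 + pr A2.
Proof.
move=> mA1 mA2 A12; apply: EFin_inj; rewrite EFinD -!prE //; last exact: measurableU.
by rewrite measureU.
Qed.

Lemma pr_split t (C : set T) (s : seq (trajectory V)) : measurable C -> uniq s ->
  pr C = pr (C `&` [set w | B t w \notin s]) +
         \sum_(p <- s) pr (C `&` [set w | B t w = p]).
Proof.
move=> mC; have mB := lsa.1.
have mN s' : measurable [set w | B t w \notin s'].
  apply: (@measurable_determined t.+1 [set h | h t \notin s']) => h h' hh /=.
  by rewrite hh.
elim: s => [_|p s IH /andP[ps us]].
  by rewrite big_nil addr0; congr pr; apply/seteqP; split=> [w|w []].
rewrite big_cons addrCA addrA addrC IH // addrC; congr (_ + _).
rewrite addrC -prU; [congr pr|apply: measurableI|apply: measurableI|] => //.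
  apply/seteqP; split=> [w [Cw /= Bs]|w [[Cw]|[Cw]] /=].
  - have [->|/eqP Bp] := eqVneq (B t w) p; [by right|left; split => //=].
    by rewrite in_cons negb_or Bs andbT; apply/eqP.
  - by rewrite in_cons negb_or => /andP[].
  - by move=> ->.
apply/seteqP; split=> // w [[_ /= Bs] [_ /= Bp]].
by move: Bs; rewrite Bp in_cons eqxx.
Qed.

Lemma pr_cylS t h p :
  pr (cyl t.+1 (upd h t p)) = pr (cyl t h) * trajectory_prob R e (load h t) p.
Proof.
apply: EFin_inj; rewrite EFinM -!prE; try exact: measurable_cyl.
rewrite (lsa.2 t (upd h t p)) load_upd {2}/upd eqxx; congr (P _ * _)%E.
by apply/seteqP; split=> w hw i it; rewrite hw ?upd_before.
Qed.

Lemma cylS t h p : cyl t.+1 (upd h t p) = cyl t h `&` [set w | B t w = p].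
Proof.
apply/seteqP; split=> [w hw|w [hw /= Bp] i].
  split; last by have := hw t (ltnSn t); rewrite /upd eqxx.
  by move=> i it; rewrite hw ?upd_before // ltnW.
rewrite ltnS leq_eqVlt => /predU1P[->|it]; first by rewrite /upd eqxx.
by rewrite upd_before ?hw.
Qed.

Definition trajectories k : seq (trajectory V) :=
  [seq (u, p) | u : V <- enum V, p : seq V <- words_upto V k].

Lemma sum_trajectories k (F : V -> seq V -> R) :
  \sum_(p <- trajectories k) F p.1 p.2 = \sum_u \sum_(q <- words_upto V k) F u q.
Proof. by rewrite big_allpairs_dep /= big_enum. Qed.

(** After t balls every load is at most t, so the listed trajectories have total conditional
    probability 1 and the part of the cylinder outside them is null. *)
Lemma pr_cyl_trajectories t h (C : set T) : (0 < #|V|)%N -> measurable C ->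
  pr (cyl t h `&` C) <=
    \sum_(p <- trajectories t) pr (cyl t.+1 (upd h t p) `&` C).
Proof.
move=> V0 mC; have mcyl := @measurable_cyl.
have ut : uniq (trajectories t).
  apply: allpairs_uniq; [exact: enum_uniq|exact: words_upto_uniq|].
  by case=> [a b] [c f] _ _ [-> ->].
have mN : measurable [set w | B t w \notin trajectories t].
  apply: (@measurable_determined t.+1 [set h | h t \notin trajectories t]).
  by move=> h1 h2 hh /=; rewrite hh.
rewrite (pr_split t (measurableI _ _ (mcyl t h) mC) ut).
have -> : \sum_(p <- trajectories t) pr (cyl t.+1 (upd h t p) `&` C) =
    \sum_(p <- trajectories t) pr (cyl t h `&` C `&` [set w | B t w = p]).
  by apply: eq_bigr => p _; rewrite cylS setIAC.
rewrite gerDr.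
have := pr_split t (mcyl t h) ut.
under eq_bigr do rewrite -cylS pr_cylS.
rewrite -mulr_sumr.
have -> : \sum_(p <- trajectories t) trajectory_prob R e (load h t) p = 1.
  rewrite (sum_trajectories _ (fun u q => #|V|%:R^-1 * walk_prob R e (load h t) u q)).
  under eq_bigr do rewrite -mulr_sumr walk_prob_sum ?load_le // mulr1.
  by rewrite sumr_const -[LHS]mulr_natr mulVf // pnatr_eq0 -lt0n.
rewrite mulr1 => /eqP; rewrite -subr_eq subrr eq_sym => /eqP N0.
rewrite -N0; apply: pr_le; [|exact: measurableI|by move=> w [[]]].
by apply: measurableI => //; exact: measurableI.
Qed.

(* Backward induction on t: conditionally on an admissible history h of       *)
(* length t, the event A has probability at most f t h.                       *)
Lemma supermartingale_bound m (A : set (nat -> trajectory V))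
    (f : nat -> (nat -> trajectory V) -> R) h0 :
  (0 < #|V|)%N -> determined m A ->
  (forall t h, (t < m)%N -> valid R e h t -> exists2 b : V -> R,
     forall u q, walk_prob R e (load h t) u q != 0 -> f t.+1 (upd h t (u, q)) <= b u &
     \sum_u b u <= #|V|%:R * f t h) ->
  (forall h, valid R e h m -> A h -> 1 <= f m h) ->
  (forall h, 0 <= f m h) ->
  (P [set w | A (B ^~ w)] <= (f 0 h0)%:E)%E.
Proof.
move=> V0 detA step final f0.
have mA := measurable_determined detA; have mcyl := @measurable_cyl.
suff main k t h : (t + k = m)%N -> valid R e h t ->
    pr (cyl t h `&` [set w | A (B ^~ w)]) <= pr (cyl t h) * f t h.
  have := main m 0%N h0 (add0n m) (fun i i0 => False_ind _ (notF i0)).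
  have -> : cyl 0 h0 = setT by apply/seteqP; split.
  by rewrite setTI [X in _ <= X * _]/pr probability_setT mul1r prE ?lee_fin.
elim: k t h => [|k IH] t h.
  rewrite addn0 => -> vh; have [Ah|nAh] := pselect (A h).
    apply: (@le_trans _ _ (pr (cyl m h))).
      by apply: pr_le; [exact: measurableI|exact: mcyl|move=> w []].
    by rewrite ler_peMr ?pr_ge0 ?final.
  rewrite (_ : _ `&` _ = set0) /pr ?measure0 ?mulr_ge0 ?fine_ge0 //.
  by apply/seteqP; split=> // w [hw /= Aw]; apply: nAh; exact: detA Aw.
move=> tk vh; have [|b fb sb] := step t h _ vh; first by lia.
apply: le_trans (pr_cyl_trajectories t h V0 mA) _.
apply: (@le_trans _ _ (\sum_(p <- trajectories t)
   pr (cyl t h) * (#|V|%:R^-1 * walk_prob R e (load h t) p.1 p.2 * b p.1))).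
  apply: ler_sum => -[u p] _ /=.
  (* A trajectory of probability zero yields no admissible history, hence no induction hypothesis,
     but its cylinder is null. *)
  have [w0|w0] := eqVneq (walk_prob R e (load h t) u p) 0.
    rewrite w0 mulr0 mul0r mulr0; have := pr_cylS t h (u, p).
    rewrite /trajectory_prob /= w0 !mulr0 => <-.
    by apply: pr_le; [exact: measurableI|exact: mcyl|move=> w []].
  apply: (@le_trans _ _ _ _ _ (IH t.+1 _ _ (valid_upd (p := (u, p)) vh w0))); first by lia.
  rewrite pr_cylS /trajectory_prob /= -!mulrA ler_wpM2l ?pr_ge0 //.
  by rewrite !ler_wpM2l ?invr_ge0 ?walk_prob_ge0 ?fb.
rewrite -mulr_sumr ler_wpM2l ?pr_ge0 //.
rewrite (sum_trajectories _
  (fun u q => #|V|%:R^-1 * walk_prob R e (load h t) u q * b u)).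
under eq_bigr do rewrite -mulr_suml -mulr_sumr walk_prob_sum ?load_le // mulr1.
by rewrite -mulr_sumr ler_pdivrMl ?ltr0n.
Qed.

End Supermartingale.

(** * An upper bound for the probability that a vertex is uncovered *)

Lemma prod_add1_le_exp (R : realType) (I : finType) (F : I -> R) :
  (forall i, 0 <= F i) -> \prod_i (1 + F i) <= expR (\sum_i F i).
Proof.
move=> F0; rewrite expR_sum; apply: ler_prod => i _.
by rewrite addr_ge0 ?F0 //= expR_ge1Dx.
Qed.

(** The logarithmic sensitivity of 1 + y: scaling y by 1 + c multiplies 1 + y by 1 + c [sat y]. *)
Definition sat (R : realType) (y : R) : R := y / (1 + y).

Lemma sat_mono (R : realType) (y z : R) : 0 <= y -> y <= z -> sat y <= sat z.
Proof.
move=> y0 yz; rewrite /sat ler_pdivrMr; last lra.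
rewrite mulrAC ler_pdivlMr; last lra.
nra.
Qed.

Lemma sat_ge0 (R : realType) (y : R) : 0 <= y -> 0 <= sat y.
Proof. by move=> y0; rewrite divr_ge0 // addr_ge0. Qed.

Section Upper.
Variables (R : realType) (V : finType) (e : rel V) (v : V).
Variables (Q : R).
Hypothesis Q2 : 2 <= Q.
Local Notation n := #|V|.
Local Notation dist := (dist R e).
Implicit Types (x : V -> nat) (a : R).

Let Q0 : 0 < Q.
Proof. by apply: lt_le_trans Q2. Qed.

Let Q1 : 1 <= Q.
Proof. by apply: le_trans Q2; rewrite ler1n. Qed.

Definition deficit a x w : R := a * Q ^- (dist v w + x w).

Definition deficit_prod a x : R := \prod_w (1 + deficit a x w).

Lemma deficit_ge0 a x w : 0 <= a -> 0 <= deficit a x w.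
Proof. by move=> a0; rewrite mulr_ge0 ?invr_ge0 ?exprn_ge0 ?(ltW Q0). Qed.

Lemma deficit_descent a x u p : 0 <= a -> path (descent e x) u p ->
  deficit a x u <= deficit a x (last u p).
Proof.
move=> a0 xp; rewrite ler_wpM2l // lef_pV2 ?posrE ?exprn_gt0 //.
apply: ler_weXn2l => //.
have := descent_size xp; have := descent_dist R v xp; lia.
Qed.

(** Growing a multiplies the product by at most exp(sum of [sat] / (2n)). The landing vertex divides
    its deficit z by Q >= 2, which gains a factor of at most 1 - [sat z] / 2. Since deficits do not
    decrease along a descent, [sat z] can be replaced by its value at the birthplace. *)
Lemma deficit_prod_step a x u p : 0 <= a -> path (descent e x) u p ->
  deficit_prod (a * (1 + (2 * n%:R)^-1)) (fun w => x w + (last u p == w))%N <=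
  deficit_prod a x * ((1 - sat (deficit a x u) / 2) *
    expR (\sum_w sat (deficit a x w) / (2 * n%:R))).
Proof.
move=> a0 xp; set x' := fun w => _; set c := (2 * n%:R)^-1.
have n0 : 0 < n%:R :> R by rewrite ltr0n; apply/card_gt0P; exists u.
have c0 : 0 <= c by rewrite invr_ge0 mulr_ge0 ?ltW.
have y0 := fun x w => deficit_ge0 x w a0.
have xx' w : deficit a x' w <= deficit a x w.
  rewrite ler_wpM2l // lef_pV2 ?posrE ?exprn_gt0 //.
  by apply: ler_weXn2l => //; rewrite /x'; lia.
apply: (@le_trans _ _ (deficit_prod a x' *
    \prod_w (1 + sat (deficit a x' w) * c))).
  rewrite -big_split /= ler_prod // => w _.
  have -> : deficit (a * (1 + c)) x' w = deficit a x' w * (1 + c).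
    by rewrite /deficit mulrAC.
  have := y0 x' w; set y := deficit a x' w => yge.
  have -> : (1 + y) * (1 + sat y * c) = 1 + y * (1 + c).
    by rewrite /sat; field; lra.
  by rewrite lexx andbT addr_ge0 // mulr_ge0 // addr_ge0.
rewrite mulrA ler_pM //.
- by apply: prodr_ge0 => w _; rewrite addr_ge0.
- by apply: prodr_ge0 => w _; rewrite addr_ge0 // mulr_ge0 ?sat_ge0.
- rewrite /deficit_prod (bigD1 (last u p)) //= [in leRHS](bigD1 (last u p)) //=.
  rewrite mulrAC ler_pM //.
  + by rewrite addr_ge0.
  + by apply: prodr_ge0 => w _; rewrite addr_ge0.
  + have -> : deficit a x' (last u p) = deficit a x (last u p) / Q.
      by rewrite /deficit /x' eqxx addnA addn1 exprS invfM mulrA mulrAC.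
    have := deficit_descent a0 xp; have := y0 x u; have := y0 x (last u p).
    set y := deficit a x u; set z := deficit a x (last u p) => z0 yge yz.
    have syz := sat_mono yge yz.
    have zz : sat z * (1 + z) = z by rewrite /sat divfK //; lra.
    have : z / Q <= z / 2 by rewrite ler_wpM2l // lef_pV2 ?posrE.
    nra.
  + apply: ler_prod => w /negbTE wp; rewrite addr_ge0 //=.
    by rewrite /deficit /x' eq_sym wp addn0.
- apply: le_trans (prod_add1_le_exp _) _ => [w|].
    by rewrite mulr_ge0 ?sat_ge0.
  by rewrite ler_expR; apply: ler_sum => w _; rewrite ler_wpM2r ?sat_mono.
Qed.

(** With s the sum of the [sat] terms, the mean factor is (1 - s/(2n)) exp(s/(2n)) <= 1. This
    balance dictates the growth rate 1/(2n) of a. *)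
Lemma deficit_prod_mean a x : 0 <= a ->
  \sum_u deficit_prod a x * ((1 - sat (deficit a x u) / 2) *
    expR (\sum_w sat (deficit a x w) / (2 * n%:R)))
  <= n%:R * deficit_prod a x.
Proof.
move=> a0; rewrite -mulr_sumr mulrC ler_wpM2r //.
  by apply: prodr_ge0 => w _; rewrite addr_ge0 // deficit_ge0.
have n0 : 0 < n%:R :> R by rewrite ltr0n; apply/card_gt0P; exists v.
rewrite -mulr_suml -mulr_suml sumrB sumr_const -mulr_suml.
set s := \sum_w _; have -> : 1 *+ n - s / 2 = n%:R * (1 - s / (2 * n%:R)).
  by field; lra.
rewrite -mulrA ger_pMr // -ler_pdivlMr ?expR_gt0 // mul1r -expRN.
exact: expR_ge1Dx.
Qed.

End Upper.

Lemma bernoulli (R : realType) (x : R) k : 0 <= x -> 1 + k%:R * x <= (1 + x) ^+ k.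
Proof.
move=> x0; elim: k => [|k IH]; first by rewrite mul0r addr0.
rewrite exprS; apply: (@le_trans _ _ ((1 + x) * (1 + k%:R * x))).
  by rewrite -natr1; have := ler0n R k; nra.
by rewrite ler_wpM2l // addr_ge0.
Qed.

Lemma local_search_uncovered_le (R : realType) (V : finType) (e : rel V)
    (d : measure_display) (T : measurableType d) (P : probability T R)
    (B : nat -> T -> trajectory V) (Delta r j : nat) (Q : R) (v : V) :
  symmetric e -> (max_degree e <= Delta)%N -> local_search_allocation e P B ->
  2 * Delta.+1%:R <= Q -> expR 3 * Q ^+ 2 <= 2 ^+ j ->
  (P [set w | load (B ^~ w) (2 * j * r * #|V|) v = 0%N] <=
   (expR 3 / expR 3 ^+ (r * #|gball R e v r|))%:E)%E.
Proof.
move=> syme degD lsa HQ Hj; set n := #|V|; set m := (2 * j * r * n)%N.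
set G := gball R e v r; set E3 := expR 3 : R.
have D1 : 1 <= Delta.+1%:R :> R by rewrite ler1n.
have Q2 : 2 <= Q by lra.
have Q0 : 0 < Q by lra.
have n0 : 0 < n%:R :> R by rewrite ltr0n; apply/card_gt0P; exists v.
pose c : R := (2 * n%:R)^-1; have c0 : 0 <= c by rewrite invr_ge0 mulr_ge0 // ltW.
have c1 t : 0 < (1 + c) ^+ t by rewrite exprn_gt0 // ltr_wpDr.
have E30 : 0 < E3 by exact: expR_gt0.
(* The final value of a: Q^(2r) cancels distance plus load over the ball of radius r, leaving
   exp(3r) per vertex. *)
pose A : R := (E3 * Q ^+ 2) ^+ r.
pose a t : R := A * (1 + c) ^+ t / (1 + c) ^+ m.
have A0 : 0 <= A by rewrite exprn_ge0 // mulr_ge0 ?exprn_ge0 ?ltW.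
have a0 t : 0 <= a t by rewrite /a divr_ge0 ?mulr_ge0 ?(ltW (c1 _)).
have aS t : a t.+1 = a t * (1 + c) by rewrite /a exprS; ring.
have am : a m = A by rewrite /a mulfK // gt_eqF.
(* m consists of j r blocks of 2n balls, and over each block a at least doubles by Bernoulli. *)
have a0_le1 : a 0%N <= 1.
  rewrite /a expr0 mulr1 ler_pdivrMr // mul1r.
  have -> : (1 + c) ^+ m = ((1 + c) ^+ (2 * n) ^+ j) ^+ r.
    by rewrite -!exprM; congr (_ ^+ _); rewrite /m; lia.
  apply: lerXn2r; rewrite ?nnegrE ?(ltW (exprn_gt0 _ _)) //.
  - by rewrite mulr_ge0 ?exprn_ge0 ?ltW.
  - apply: le_trans Hj _; apply: lerXn2r; rewrite ?nnegrE ?(ltW (c1 _)) //.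
    apply: le_trans (bernoulli _ c0).
    rewrite /c natrM mulfV ?mulf_neq0 ?gt_eqF //.
pose f t h : R :=
  deficit_prod e v Q (a t) (load h t) / E3 ^+ (r * #|G|).
have dp0 t x : 0 <= deficit_prod e v Q (a t) x.
  by apply: prodr_ge0 => w _; rewrite addr_ge0 // deficit_ge0.
have f0 t h : 0 <= f t h by rewrite divr_ge0 // exprn_ge0 // ltW.
pose h0 : nat -> trajectory V := fun=> (v, [::]).
apply: (@le_trans _ _ (f 0%N h0)%:E); last first.
  rewrite lee_fin ler_pM2r ?invr_gt0 ?exprn_gt0 //.
  apply: le_trans (prod_add1_le_exp _) _ => [w|]; first exact: deficit_ge0.
  rewrite ler_expR; apply: le_trans (sum_dist_weight degD v HQ).
  apply: ler_sum => w _; rewrite /deficit load0 addn0 ler_piMl //.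
  by rewrite invr_ge0 exprn_ge0 // ltW.
apply: (@supermartingale_bound R V e d T P B lsa m [set h | load h m v = 0%N] f).
- by apply/card_gt0P; exists v.
- by move=> h h' hh' /=; rewrite (eq_load hh').
- move=> t h tm vh.
  exists (fun u => deficit_prod e v Q (a t) (load h t) *
    ((1 - sat (deficit e v Q (a t) (load h t) u) / 2) *
    expR (\sum_w sat (deficit e v Q (a t) (load h t) w) / (2 * n%:R)))
    / E3 ^+ (r * #|G|)).
    move=> u q /walk_prob_descent[xq _]; rewrite /f.
    rewrite ler_pM2r ?invr_gt0 ?exprn_gt0 // aS.
    have -> : load (upd h t (u, q)) t.+1 =
        fun w => (load h t w + (last u q == w))%N.
      by apply/funext => w; rewrite load_updS.
    exact: deficit_prod_step.
  rewrite -[leLHS]mulr_suml /f mulrA ler_pM2r ?invr_gt0 ?exprn_gt0 //.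
  exact: deficit_prod_mean.
- move=> h vh /= hv; rewrite /f ler_pdivlMr ?exprn_gt0 // mul1r am.
  have -> : E3 ^+ (r * #|G|) = \prod_w (if w \in G then E3 ^+ r else 1).
    by rewrite -big_mkcond /= prodr_const -exprM.
  apply: ler_prod => w _; case: ifPn => wG; last first.
    by rewrite ler01 lerDl deficit_ge0.
  rewrite exprn_ge0 ?(ltW E30) //=.
  apply: (@le_trans _ _ (deficit e v Q A (load h m) w)); last by rewrite lerDr.
  rewrite /deficit ler_pdivlMr ?exprn_gt0 // /A exprMn ler_wpM2l //.
    by rewrite exprn_ge0 // ltW.
  rewrite -exprM; apply: ler_weXn2l; first lra.
  by rewrite mul2n -addnn leq_add ?dist_le // -[leqRHS]add0n -hv (load_ball syme vh wG).
- by move=> h; exact: f0.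
Qed.

(** * An upper bound for the probability that all vertices are covered *)

(** A ball lands at a load no larger than that of its birthplace, so the sum of M^load grows in mean
    by a factor of at most 1 + M/n per ball; Markov's inequality concludes. *)
Lemma local_search_max_load_le (R : realType) (V : finType) (e : rel V)
    (d : measure_display) (T : measurableType d) (P : probability T R)
    (B : nat -> T -> trajectory V) (m L : nat) (M : R) :
  (0 < #|V|)%N -> local_search_allocation e P B -> 1 <= M ->
  (P [set w | exists v, (L < load (B ^~ w) m v)%N] <=
   (#|V|%:R * (1 + M / #|V|%:R) ^+ m / M ^+ L.+1)%:E)%E.
Proof.
move=> V0 lsa M1; set n := #|V|; have M0 : 0 < M by lra.
have n0 : 0 < n%:R :> R by rewrite ltr0n.
pose c : R := 1 + M / n%:R.
have c0 : 0 <= c by rewrite addr_ge0 // divr_ge0 ?ltW.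
pose W (x : V -> nat) : R := \sum_w M ^+ x w.
have W0 x : 0 <= W x by apply: sumr_ge0 => w _; rewrite exprn_ge0 // ltW.
pose f t (h : nat -> trajectory V) : R := c ^+ (m - t) * W (load h t) / M ^+ L.+1.
have [v0 _] := card_gt0P V0; pose h0 : nat -> trajectory V := fun=> (v0, [::]).
have -> : n%:R * c ^+ m / M ^+ L.+1 = f 0%N h0.
  rewrite /f /W; under eq_bigr do rewrite load0 expr0.
  by rewrite subn0 sumr_const [n%:R * _]mulrC.
apply: (@supermartingale_bound R V e d T P B lsa m
  [set h | exists v, (L < load h m v)%N] f) => //.
- by move=> h h' hh' [v]; rewrite (eq_load hh'); exists v.
- move=> t h tm vh; set x := load h t.
  exists (fun u => c ^+ (m - t.+1) * (W x + M * M ^+ x u) / M ^+ L.+1).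
    move=> u q /walk_prob_descent[xq _]; rewrite /f.
    rewrite ler_pM2r ?invr_gt0 ?exprn_gt0 //; apply: ler_wpM2l.
      exact: exprn_ge0.
    rewrite /W (bigD1 (last u q)) //= [in leRHS](bigD1 (last u q)) //=.
    rewrite load_updS /final_vertex /= eqxx addn1 exprS -/x.
    have xle : M ^+ x (last u q) <= M ^+ x u.
      by apply: ler_weXn2l => //; have := descent_size xq; lia.
    under eq_bigr => w wq do rewrite load_updS /final_vertex /= eq_sym (negbTE wq) addn0.
    have : 0 <= M ^+ x (last u q) by rewrite exprn_ge0 // ltW.
    rewrite -/x; nra.
  rewrite -mulr_suml -mulr_sumr big_split /= sumr_const -mulr_sumr -/(W x).
  have cS : c ^+ (m - t) = c * c ^+ (m - t.+1) by rewrite -exprS; congr (_ ^+ _); lia.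
  rewrite /f -/x cS -[W x *+ _]mulr_natl -[#|_|]/n -/n -/c le_eqVlt.
  set u := c ^+ _; set z := M ^+ L.+1; have z0 : z != 0 by rewrite gt_eqF ?exprn_gt0.
  by apply/orP; left; apply/eqP; rewrite /c; field; rewrite z0 gt_eqF.
- move=> h _ [v vL]; rewrite /f subnn mul1r ler_pdivlMr ?exprn_gt0 // mul1r.
  rewrite /W (bigD1 v) //= -[leLHS]addr0 lerD //; first exact: ler_weXn2l.
  by apply: sumr_ge0 => w _; rewrite exprn_ge0 // ltW.
- by move=> h; rewrite divr_ge0 ?mulr_ge0 ?exprn_ge0 // ltW.
Qed.

Lemma expR_le_quadratic (R : realType) (x : R) :
  x <= 1 / 2 -> expR x <= 1 + x + 2 * x ^+ 2.
Proof.
move=> x2; have := expR_ge1Dx (- x); rewrite expRN => Hx.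
have e0 := expR_gt0 x.
have : (1 - x) * expR x <= 1 by rewrite -ler_pdivlMr // div1r.
have : 0 <= x ^+ 2 * (1 - 2 * x) by rewrite mulr_ge0 ?sqr_ge0 //; lra.
rewrite expr2; nra.
Qed.

Lemma sum_expR_le (R : realType) (I : finType) (Y : I -> R) (eps : R) :
  (0 < #|I|)%N ->
  (forall i, Y i <= 1 / 2) -> (forall i, Y i ^+ 2 <= eps) ->
  \sum_i expR (Y i) <= #|I|%:R * expR ((\sum_i Y i) / #|I|%:R + 2 * eps).
Proof.
move=> I0 Y2 Ye; have n0 : 0 < #|I|%:R :> R by rewrite ltr0n.
apply: (@le_trans _ _ (\sum_i (1 + 2 * eps + Y i))).
  apply: ler_sum => i _; apply: le_trans (expR_le_quadratic (Y2 i)) _.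
  by have := Ye i; lra.
rewrite big_split /= sumr_const -[X in X + _]mulr_natl; set k := #|I| in n0 *.
have -> : k%:R * (1 + 2 * eps) + \sum_i Y i =
    k%:R * (1 + ((\sum_i Y i) / k%:R + 2 * eps)).
  by field; rewrite gt_eqF.
by rewrite ler_wpM2l ?expR_ge1Dx // ltW.
Qed.

(** * The excess potential around an uncovered vertex *)

Section Lower.
Variables (R : realType) (V : finType) (e : rel V) (Q : R).
Hypothesis syme : symmetric e.
Hypothesis Q2 : 2 <= Q.
Local Notation n := #|V|.
Local Notation dist := (dist R e).
Implicit Types (x : V -> nat) (h : nat -> trajectory V).

Let Q0 : 0 < Q.
Proof. by apply: lt_le_trans Q2. Qed.

Let Q1 : 1 <= Q.
Proof. by apply: le_trans Q2; rewrite ler1n. Qed.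

Lemma descent_dist_rev x u p v : path (descent e x) u p ->
  (dist v u <= dist v (last u p) + size p)%N.
Proof.
elim: p u => [|w p IH] u /=; first by rewrite addn0.
case/andP => /andP[]; rewrite syme => wu _ /IH.
have := @distS R _ _ v _ _ wu; lia.
Qed.

(** Q^(2 x(w) - dist(v, w)), as a quotient because the exponent may be negative. The factor 2 leaves
    a surplus: a vertex from which a ball descends l steps to v has load at least l and distance at
    most l, so its excess is at least Q^l. *)
Definition excess v x w : R := Q ^+ (2 * x w) / Q ^+ dist v w.

Definition excess_sum v x : R := \sum_w excess v x w.

Lemma excess_ge0 v x w : 0 <= excess v x w.
Proof. by rewrite divr_ge0 // exprn_ge0 // (ltW Q0). Qed.

Lemma excess_descent v x u p : path (descent e x) u p ->
  excess v x (last u p) <= excess v x u.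
Proof.
move=> xp; rewrite /excess ler_pdivrMr ?exprn_gt0 // mulrAC.
rewrite ler_pdivlMr ?exprn_gt0 // -!exprD; apply: ler_weXn2l => //.
have := descent_size xp; have := descent_dist_rev v xp; lia.
Qed.

Lemma excess_sum_step v x u p : path (descent e x) u p ->
  excess_sum v (fun w => x w + (last u p == w))%N <=
  excess_sum v x + Q ^+ 2 * excess v x u.
Proof.
move=> xp; rewrite /excess_sum (bigD1 (last u p)) //= [in leRHS](bigD1 (last u p)) //=.
under eq_bigr => w wq do rewrite /excess eq_sym (negbTE wq) addn0.
have -> : excess v (fun w => (x w + (last u p == w))%N) (last u p) =
    Q ^+ 2 * excess v x (last u p).
  by rewrite /excess eqxx mulnDr muln1 exprD mulrA [Q ^+ 2 * _]mulrC.
rewrite addrAC lerD2r -[leLHS]add0r lerD ?excess_ge0 //.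
by rewrite ler_wpM2l ?exprn_ge0 ?(ltW Q0) // excess_descent.
Qed.

Definition no_birth (r : nat) v h t : bool :=
  [forall i : 'I_t, birthplace (h i) \notin gball R e v r].

Lemma no_birthS r v h t :
  no_birth r v h t.+1 = no_birth r v h t && (birthplace (h t) \notin gball R e v r).
Proof.
apply/forallP/andP => [nb|[/forallP nb nbt] [i it]].
  split; last exact: (nb (Ordinal (ltnSn t))).
  by apply/forallP => -[i it]; exact: (nb (Ordinal (leqW it))).
rewrite /=; move: it; rewrite ltnS leq_eqVlt => /predU1P[->//|it].
exact: (nb (Ordinal it)).
Qed.

Lemma eq_no_birth r v h h' t : (forall i, (i < t)%N -> h i = h' i) ->
  no_birth r v h t = no_birth r v h' t.
Proof. by move=> hh; apply: eq_forallb => -[i it] /=; rewrite hh. Qed.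

(* A ball covering v without a birth nearby descends from a vertex whose load  *)
(* is at least its distance, itself more than r, from v.                       *)
Lemma covered_excess r v h m : valid R e h m -> no_birth r v h m ->
  (0 < load h m v)%N -> Q ^+ r <= excess_sum v (load h m).
Proof.
move=> vh nb hv; have [i im fi] : exists2 i, (i < m)%N & final_vertex (h i) = v.
  move: hv; elim: m {vh nb} => [|m IH]; first by rewrite load0.
  rewrite loadS; case: eqP => [<- _|_]; first by exists m.
  by rewrite addn0 => /IH[i im <-]; exists i => //; rewrite ltnW.
have [xp _] := walk_prob_descent (vh i im).
set u := birthplace (h i); set l := size (h i).2.
have vu : v \in gball R e u l.
  by apply/gballP; exists (h i).2; split => //; exact: descent_path xp.
have {}vu : u \in gball R e v l by exact: gball_sym vu.
have rl : (r < l)%N.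
  rewrite ltnNge; apply/negP => lr; move/forallP: nb => /(_ (Ordinal im)).
  by rewrite (fintype.subsetP (gball_mono R e v lr)).
have ul : (l <= load h m u)%N.
  apply: leq_trans (load_mono h u (ltnW im)).
  by have := descent_size xp; rewrite -/u -/l; lia.
rewrite /excess_sum (bigD1 u) //= -[leLHS]addr0 lerD //; last first.
  by apply: sumr_ge0 => w _; exact: excess_ge0.
rewrite /excess ler_pdivlMr ?exprn_gt0 // -exprD; apply: ler_weXn2l => //.
have := dist_le vu; lia.
Qed.

End Lower.

(** * Exponential moments of the number of surviving vertices *)

Section Survival.
Variables (R : realType) (V : finType) (e : rel V) (Q : R) (Delta r b L : nat).
Hypothesis syme : symmetric e.
Hypothesis degD : (max_degree e <= Delta)%N.
Hypothesis HQ : 2 * Delta.+1%:R <= Q.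
Hypothesis card_ball : forall v, #|gball R e v r| = b.
Local Notation n := (#|V|).
Local Notation dist := (dist R e).
Local Notation exc := (excess e Q).
Local Notation exc_sum := (excess_sum e Q).
Implicit Types (x : V -> nat) (h : nat -> trajectory V) (c : V -> R).

(** The probability that a birth misses the ball of radius r around a given vertex. *)
Let p : R := 1 - b%:R / n%:R.
(** The excess sum grows in mean by at most 1 + Q^2/n; the factor 2 pays for restricting to births
    away from v, of probability p >= 1/2. *)
Let a : R := 1 + 2 * Q ^+ 2 / n%:R.
Let y : R := Q ^+ (2 * L).
Let D : R := (b%:R + Q ^+ 2) * y.

Let Q2 : 2 <= Q.
Proof.
by have H := HQ; have D1 : 1 <= Delta.+1%:R :> R by [rewrite ler1n]; lra.
Qed.

Let Q0 : 0 < Q.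
Proof. by apply: lt_le_trans Q2. Qed.

Let Q1 : 1 <= Q.
Proof. by apply: le_trans Q2; rewrite ler1n. Qed.

Let y1 : 1 <= y.
Proof. exact: exprn_ege1. Qed.

(** A lower bound, depending only on the birthplace u, for the weighted survival sum after the next
    ball. *)
Definition survival (A : R) c x u : R :=
  \sum_v c v * (if u \in gball R e v r then 0
                else 1 - A * (exc_sum v x + Q ^+ 2 * exc v x u)).

Lemma excess_le v x w : (x w <= L)%N -> exc v x w <= y * Q ^- dist v w.
Proof.
move=> xL; apply: ler_wpM2r; first by rewrite invr_ge0 exprn_ge0 // ltW.
by apply: ler_weXn2l => //; lia.
Qed.

Lemma excess_sum_le v x : (forall w, (x w <= L)%N) -> exc_sum v x <= 3 * y.
Proof.
move=> xL; apply: (@le_trans _ _ (\sum_w y * Q ^- dist v w)).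
  by apply: ler_sum => w _; exact: excess_le.
rewrite -mulr_sumr mulrC ler_wpM2r ?(sum_dist_weight degD) //.
exact: le_trans y1.
Qed.

(** One Azuma step: the survival sum is a constant minus a loss [Y u] with |Y u| <= D, and
    [sum_expR_le] bounds the exponential moment by the mean and the second-order term 2 (lam
    D)^2. *)
Lemma survival_mean (A lam : R) c x :
  (0 < n)%N -> 1 / 2 <= p -> 0 <= A -> 6 * A <= 1 -> 0 <= lam ->
  lam * D <= 1 / 2 ->
  (forall v, 0 <= c v <= 1) -> (forall w, (x w <= L)%N) ->
  \sum_u expR (- lam * survival A c x u) <=
  n%:R * expR (- lam * (\sum_v c v * p * (1 - a * A * exc_sum v x)) +
               2 * (lam * D) ^+ 2).
Proof.
move=> nV p2 A0 A6 lam0 lamD c01 xL.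
have q2 := Q2; have yy := y1; have q0 := Q0.
have n0 : 0 < n%:R :> R by rewrite ltr0n.
pose Phi v := exc_sum v x; pose phi v u := exc v x u.
have phi0 v u : 0 <= phi v u by exact: excess_ge0.
have Phi0 v : 0 <= Phi v by apply: sumr_ge0 => w _; exact: phi0.
have Phi3 v : Phi v <= 3 * y by exact: excess_sum_le.
have AQ0 : 0 <= A * Q ^+ 2 by rewrite mulr_ge0 ?exprn_ge0 // ltW.
pose B0 : R := \sum_v c v * (1 - A * Phi v).
pose loss v u := if u \in gball R e v r then 1 - A * Phi v else A * Q ^+ 2 * phi v u.
pose Y u : R := \sum_v c v * loss v u.
have survE u : survival A c x u = B0 - Y u.
  rewrite /survival /B0 /Y -sumrB; apply: eq_bigr => v _; rewrite /loss -/(phi v u) -/(Phi v).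
  by case: ifP => _; ring.
(* A birth at u kills only the b vertices v within distance r, at a cost of at most y each. It
   affects the others through excesses at most y Q^-dist, whose weights sum to at most 3. *)
have normY u : `|Y u| <= D.
  apply: le_trans (ler_norm_sum _ _ _) _.
  apply: (@le_trans _ _ (\sum_v ((if v \in gball R e u r then y else 0)
      + A * Q ^+ 2 * y * Q ^- dist u v))).
    apply: ler_sum => v _; have /andP[c0 c1] := c01 v.
    rewrite normrM (ger0_norm c0); apply: (@le_trans _ _ `|loss v u|).
      by rewrite ler_piMl.
    have uv : (v \in gball R e u r) = (u \in gball R e v r).
      by apply/idP/idP; exact: gball_sym.
    have Qd : 0 <= A * Q ^+ 2 * y * Q ^- dist u v.
      by rewrite mulr_ge0 ?invr_ge0 ?exprn_ge0 ?mulr_ge0 //; lra.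
    rewrite /loss uv; case: ifP => _.
      apply: (@le_trans _ _ y); last by rewrite lerDl.
      have := Phi0 v; have := Phi3 v; rewrite ler_norml.
      by move=> ? ?; apply/andP; split; nra.
    rewrite add0r ger0_norm; last by rewrite mulr_ge0.
    by rewrite -[leRHS]mulrA ler_wpM2l // dist_sym // excess_le.
  rewrite big_split /= -big_mkcond /= sumr_const card_ball -mulr_sumr.
  have S3 := sum_dist_weight degD u HQ.
  have S0 : 0 <= \sum_w Q ^- dist u w.
    by apply: sumr_ge0 => w _; rewrite invr_ge0 exprn_ge0 // ltW.
  rewrite -mulr_natl /D mulrDl lerD2l.
  apply: (@le_trans _ _ (A * Q ^+ 2 * y * 3)).
    by rewrite ler_wpM2l // mulr_ge0 //; lra.
  have : 0 <= Q ^+ 2 * y by rewrite mulr_ge0 ?exprn_ge0 //; lra.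
  nra.
have D0 : 0 <= D.
  by rewrite /D mulr_ge0 ?addr_ge0 ?ler0n ?exprn_ge0 //; lra.
have sumY : (\sum_u Y u) / n%:R <= B0 - \sum_v c v * p * (1 - a * A * Phi v).
  rewrite /Y exchange_big /= ler_pdivrMr // /B0 -sumrB mulr_suml.
  apply: ler_sum => v _; have /andP[c0 _] := c01 v.
  rewrite -mulr_sumr -[c v * p * _]mulrA -mulrBr -[leRHS]mulrA; apply: ler_wpM2l => //.
  apply: (@le_trans _ _ (b%:R * (1 - A * Phi v) + A * Q ^+ 2 * Phi v)).
    have -> : A * Q ^+ 2 * Phi v = \sum_u A * Q ^+ 2 * phi v u.
      by rewrite -mulr_sumr.
    rewrite -(card_ball v) mulr_natl -sumr_const [X in _ <= X + _]big_mkcond -big_split /=.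
    apply: ler_sum => u _; rewrite /loss -/(phi v u).
    by case: ifP => _; rewrite ?add0r // lerDl mulr_ge0.
  have AP : 0 <= A * Phi v by rewrite mulr_ge0.
  have bp : b%:R = (1 - p) * n%:R by rewrite /p; field; lra.
  have an : a * n%:R = n%:R + 2 * Q ^+ 2 by rewrite /a; field; lra.
  have -> : (1 - A * Phi v - p * (1 - a * A * Phi v)) * n%:R =
     (1 - A * Phi v - p) * n%:R + p * (a * n%:R) * (A * Phi v) by ring.
  rewrite bp an.
  have : 0 <= Q ^+ 2 * (A * Phi v) * (2 * p - 1).
    by rewrite mulr_ge0 ?mulr_ge0 ?exprn_ge0 //; lra.
  nra.
under eq_bigr => u _.
  have -> : - lam * survival A c x u = - lam * B0 + lam * Y u by rewrite survE; ring.
  rewrite expRD; over.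
rewrite -mulr_sumr.
have Yhalf u : lam * Y u <= 1 / 2.
  by apply: le_trans lamD; rewrite ler_wpM2l // (le_trans (ler_norm _)).
have Ysq u : (lam * Y u) ^+ 2 <= (lam * D) ^+ 2.
  rewrite -(real_normK (num_real (lam * Y u))) lerXn2r ?nnegrE ?normr_ge0 ?(mulr_ge0 lam0 D0) //.
  by rewrite normrM ger0_norm // ler_wpM2l.
apply: (@le_trans _ _ _ _ _ (ler_wpM2l _ (sum_expR_le nV Yhalf Ysq))).
  exact: expR_ge0.
rewrite mulrCA ler_wpM2l ?(ltW n0) // -expRD ler_expR -mulr_sumr -[lam * _ / _]mulrA.
rewrite addrA lerD2r -/(Phi).
nra.
Qed.

Lemma local_search_cover_le (d : measure_display) (T : measurableType d)
    (P : probability T R) (B : nat -> T -> trajectory V) (m : nat) (lam : R) :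
  local_search_allocation e P B -> (0 < n)%N -> 1 / 2 <= p ->
  6 * a ^+ m <= Q ^+ r -> 0 <= lam -> lam * D <= 1 / 2 ->
  (P [set w | forall v, (0 < load (B ^~ w) m v <= L)%N] <=
   (expR (- lam * (n%:R * p ^+ m / 2) + 2 * (lam * D) ^+ 2 * m%:R))%:E)%E.
Proof.
move=> lsa nV p2 am lam0 lamD.
have n0 : 0 < n%:R :> R by rewrite ltr0n.
have p0 : 0 <= p by lra.
have p1 : p <= 1 by rewrite /p gerBl divr_ge0.
have a1 : 1 <= a by rewrite /a lerDl divr_ge0 ?mulr_ge0 ?exprn_ge0 // ltW.
have Qr0 : 0 < Q ^+ r by rewrite exprn_gt0.
pose nb v h t : R := (no_birth R e r v h t)%:R.
pose A t : R := a ^+ (m - t) / Q ^+ r.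
have a0 : 0 <= a by exact: le_trans a1.
have A0 t : 0 <= A t by apply: divr_ge0; [exact: exprn_ge0|exact: ltW].
have A6 t : 6 * A t <= 1.
  rewrite /A mulrA ler_pdivrMr // mul1r; apply: le_trans am.
  by apply: ler_wpM2l; [|apply: ler_weXn2l; [exact: a1|exact: leq_subr]].
pose S t h := \sum_v p ^+ (m - t) * nb v h t * (1 - A t * exc_sum v (load h t)).
pose bounded h t := [forall w, (load h t w <= L)%N].
(* Zero once a load exceeds L: loads never decrease, so such histories cannot end in the event, and
   the increment bound is needed only below L. *)
pose f t h : R :=
  if bounded h t then expR (- lam * S t h + 2 * (lam * D) ^+ 2 * (m - t)%:R) else 0.
have [v0 _] := card_gt0P nV; pose h0 : nat -> trajectory V := fun=> (v0, [::]).
apply: (@le_trans _ _ (f 0%N h0)%:E); last first.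
  rewrite lee_fin /f; have -> : bounded h0 0%N by apply/forallP => w; rewrite load0.
  rewrite ler_expR subn0 lerD2r !mulNr lerN2 ler_wpM2l //.
  have -> : n%:R * p ^+ m / 2 = \sum_(v : V) p ^+ m / 2.
    by rewrite sumr_const -[RHS]mulr_natl mulrA.
  apply: ler_sum => v _; rewrite /nb (_ : no_birth _ _ _ _ _ _ = true); last first.
    by apply/forallP => -[].
  rewrite subn0 mulr1 ler_wpM2l ?exprn_ge0 //.
  have E3 : exc_sum v (load h0 0) <= 3.
    apply: le_trans (sum_dist_weight degD v HQ).
    by apply: ler_sum => w _; rewrite /excess load0 muln0 expr0 mul1r.
  have := A6 0%N; have := A0 0%N; nra.
apply: (@supermartingale_bound R V e d T P B lsa m
  [set h | forall v, (0 < load h m v <= L)%N] f) => //.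
- by move=> h h' hh' /=; rewrite (eq_load hh').
- move=> t h tm vh; set x := load h t; pose k := (m - t.+1)%N.
  have mt : (m - t)%N = k.+1 by rewrite /k subnSK.
  pose c v := p ^+ k * nb v h t.
  exists (fun u => if bounded h t then
    expR (- lam * survival (A t.+1) c x u) * expR (2 * (lam * D) ^+ 2 * k%:R) else 0).
    move=> u q /walk_prob_descent[xq _]; rewrite /f.
    have x'E : load (upd h t (u, q)) t.+1 = fun w => (x w + (last u q == w))%N.
      by apply/funext => w; rewrite load_updS.
    case: ifPn => bh'; last by case: ifP => // _; rewrite mulr_ge0 ?expR_ge0.
    have -> : bounded h t.
      apply/forallP => w; have /forallP/(_ w) := bh'; rewrite x'E.
      exact: leq_trans (leq_addr _ _).
    rewrite -expRD ler_expR lerD2r !mulNr lerN2 ler_wpM2l //.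
    apply: ler_sum => v _; rewrite /c -[leLHS]mulrA -[leRHS]mulrA ler_wpM2l ?exprn_ge0 //.
    rewrite x'E /nb no_birthS /upd eqxx /=.
    rewrite (@eq_no_birth R _ _ _ _ _ h); last first.
      by move=> i it; case: eqP => // ie; move: it; rewrite ie ltnn.
    case: (no_birth _ _ _ _ _ _); rewrite ?mul0r //= !mul1r.
    case: ifPn => _; rewrite ?mul0r // mul1r lerD2l lerN2 ler_wpM2l //.
    exact: (excess_sum_step syme Q2 v xq).
  rewrite /f; case: ifPn => bh; last by rewrite big1 ?mulr0.
  rewrite -mulr_suml mt -(natr1 k) mulrDr mulr1 [X in _ + X]addrC addrA expRD mulrA.
  rewrite ler_wpM2r ?expR_ge0 //.
  apply: le_trans (survival_mean _ _ _ _ _ _ _ _) _ => //.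
  + move=> v; rewrite /c /nb; case: (no_birth _ _ _ _ _ _) => /=.
      by rewrite mulr1 exprn_ge0 // exprn_ile1.
    by rewrite mulr0 lexx ler01.
  + by move=> w; have /forallP := bh; apply.
  rewrite ler_wpM2l ?(ltW n0) // ler_expR lerD2r !mulNr lerN2 ler_wpM2l //.
  rewrite /S mt; apply: ler_sum => v _; rewrite /c exprS /A mt exprS.
  by rewrite le_eqVlt; apply/orP; left; apply/eqP; ring.
(* When everything is covered, each vertex without nearby births has excess sum at least Q^r
   ([covered_excess]), so no term of S is positive and f >= 1. *)
- move=> h vh cov; rewrite /f.
  have -> : bounded h m by apply/forallP => w; have /andP[] := cov w.
  rewrite subnn mulr0 addr0 -expR0 ler_expR mulNr oppr_ge0.
  rewrite mulr_ge0_le0 //; apply: sumr_le0 => v _; rewrite subnn mul1r /nb.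
  case nbv : (no_birth _ _ _ _ _ _); rewrite ?mul0r // mul1r subr_le0.
  rewrite /A subnn expr0 div1r ler_pdivlMl // mulr1.
  by apply: (covered_excess syme Q2 vh nbv); have /andP[] := cov v.
- by move=> h; rewrite /f; case: ifP => // _; exact: expR_ge0.
Qed.

End Survival.

(** * The radius R_2 and the choice of constants *)

Lemma nat_inf_ge (R : realType) (A : set nat) (y : R) :
  (y%:E <= nat_inf R A)%E <-> forall k, A k -> y <= k%:R.
Proof.
split=> [yA k Ak|yA].
  by rewrite -lee_fin; apply: le_trans yA _; apply: ereal_inf_lbound; exists k.
by apply: le_ereal_inf_tmp => _ [k Ak <-]; rewrite lee_fin yA.
Qed.

Lemma measure_exists_le (R : realType) (d : measure_display) (T : measurableType d)
    (P : probability T R) (I : finType) (A : I -> set T) (eps : R) :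
  (forall i, measurable (A i)) -> (forall i, (P (A i) <= eps%:E)%E) ->
  (P [set w | exists i, A i w] <= (#|I|%:R * eps)%:E)%E.
Proof.
move=> mA PA; rewrite cardE.
have -> : [set w | exists i, A i w] = \big[setU/set0]_(i <- enum I) A i.
  rewrite -bigcup_seq; apply/seteqP; split=> [w [i Ai]|w [i _ Ai]]; exists i => //=.
  by rewrite mem_enum.
elim: (enum I) => [|i s IH]; first by rewrite big_nil measure0 mul0r.
rewrite big_cons /= -natr1 mulrDl mul1r addrC EFinD.
have ms : measurable (\big[setU/set0]_(i <- s) A i) by exact: bigsetU_measurable.
exact: le_trans (measureU2 _ (mA i) ms) (leeD (PA i) IH).
Qed.

Section RTwo.
Variables (R : realType) (V : finType) (e : rel V) (Delta : nat).
Hypothesis degD : (max_degree e <= Delta)%N.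
Hypothesis vt : vertex_transitive e.
Local Notation r := (R2 R e).
Local Notation n := #|V|.

Lemma R2_ge v : ln n%:R <= r%:R * #|gball R e v r|%:R :> R.
Proof. by rewrite /R2; case: ex_minnP => k /andP[_ /forallP]. Qed.

Lemma R2_gt0 : (0 < r)%N.
Proof. by rewrite /R2; case: ex_minnP => k /andP[]. Qed.

Lemma R2_gt1 : (0 < n)%N -> Delta.+1%:R < ln n%:R :> R -> (1 < r)%N.
Proof.
case/card_gt0P => v _ lnD; have := R2_gt0; rewrite leq_eqVlt => /predU1P[r1|//].
have := R2_ge v; rewrite -r1 mul1r leNgt => /negP[]; apply: le_lt_trans lnD.
by rewrite ler_nat; have := card_gball R degD v 1; rewrite expn1.
Qed.

(** Minimality makes the inequality fail at radius r - 1 for some vertex; by transitivity it fails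
    at every vertex. *)
Lemma R2_pred_lt v : (1 < r)%N -> r.-1%:R * #|gball R e v r.-1|%:R < ln n%:R :> R.
Proof.
move=> r1; rewrite ltNge; apply/negP => le; suff : (r <= r.-1)%N.
  by rewrite leqNgt ltn_predL R2_gt0.
rewrite {1}/R2; case: ex_minnP => k _; apply; rewrite /R2_pred -ltnS prednK ?R2_gt0 // r1.
by apply/forallP => u; rewrite (vertex_transitive_card_gball R u v _ vt).
Qed.

(** Passing from radius r - 1 to r costs a factor 2 in the radius, since r >= 2, and Delta + 1 in
    the size of the ball. *)
Lemma R2_card_gball v : (1 < r)%N ->
  (r * #|gball R e v r|)%:R <= 2 * Delta.+1%:R * ln n%:R :> R.
Proof.
move=> r1; have := R2_pred_lt v r1; have := card_gballS R degD v r.-1.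
rewrite prednK ?R2_gt0 //; move: r1.
move: (#|gball R e v r|) (#|gball R e v r.-1|) => c c'; move: (r) => k k1 cb lt.
apply: (@le_trans _ _ (2 * Delta.+1%:R * (k.-1%:R * c'%:R))).
  rewrite -!natrM ler_nat; apply: (@leq_trans (2 * k.-1 * (Delta.+1 * c'))); last lia.
  by apply: leq_mul => //; lia.
by rewrite ler_wpM2l ?mulr_ge0 // ltW.
Qed.

Lemma R2_le_ln : (0 < n)%N -> (1 < r)%N -> r%:R <= 2 * ln n%:R :> R.
Proof.
case/card_gt0P => v _ r1; have := R2_pred_lt v r1.
have : (1 <= #|gball R e v r.-1|)%N.
  by apply/card_gt0P; exists v; exact: gball_refl.
move: r1; move: (#|gball R e v r.-1|) => c; move: (r) => k k1 c1 lt.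
apply: (@le_trans _ _ (2 * (k.-1%:R * c%:R))); last by rewrite ler_wpM2l // ltW.
rewrite -!natrM ler_nat; apply: (@leq_trans (2 * k.-1)); first lia.
by rewrite leq_mul2l leq_pmulr.
Qed.

End RTwo.

Lemma expRN2_le (R : realType) (x : R) : 0 <= x -> x <= 1 / 2 -> expR (- (2 * x)) <= 1 - x.
Proof.
move=> x0 x2; rewrite expRN -div1r ler_pdivrMr ?expR_gt0 //.
apply: (@le_trans _ _ ((1 - x) * (1 + 2 * x))); first nra.
by rewrite ler_wpM2l ?expR_ge1Dx // subr_ge0; lra.
Qed.

Lemma expr1D_le_expR (R : realType) (x : R) m : 0 <= x -> (1 + x) ^+ m <= expR (x * m%:R).
Proof.
move=> x0; rewrite expRM_natr lerXn2r ?nnegrE ?expR_ge0 ?expR_ge1Dx //.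
by rewrite addr_ge0.
Qed.

Lemma expR_half_le2 (R : realType) : expR (1 / 2 : R) <= 2.
Proof. by apply: le_trans (expR_le_quadratic _) _; rewrite // expr2; lra. Qed.

(** With lam = z^-7 the gain lam S / 2 is at least z^2 / 2 and the variance term at most 40 K^2 z.
    The lower bound on z leaves an exponent of at least 4 + 10 z, and exp(4 + 10 z) >= 4 z^10. *)
Lemma azuma_exponent (R : realType) (z K N S D mm : R) :
  1 <= K -> 80 * K ^+ 2 + 28 <= z -> z ^+ 10 = N -> z ^+ 9 <= S ->
  0 <= D -> D <= K * z ^+ 2 -> 0 <= mm -> mm <= 20 * z ^+ 11 ->
  (z ^+ 7)^-1 * D <= 1 / 2 /\
  expR (- (z ^+ 7)^-1 * (S / 2) + 2 * ((z ^+ 7)^-1 * D) ^+ 2 * mm) <= (4 * N)^-1.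
Proof.
move=> K1 zK zN zS D0 DK m0 mz.
have z0 : 0 < z by nra.
have z7 : 0 < z ^+ 7 by rewrite exprn_gt0.
set lam := (z ^+ 7)^-1; have lam0 : 0 < lam by rewrite invr_gt0.
have lz7 : lam * z ^+ 7 = 1 by rewrite mulVf // gt_eqF.
have lD : lam * D <= K * (lam * z ^+ 2).
  by apply: (@le_trans _ _ (lam * (K * z ^+ 2))); [rewrite ler_wpM2l // ltW|rewrite mulrCA].
split.
  apply: le_trans lD _; have -> : lam * z ^+ 2 = z ^- 5.
    by rewrite /lam; field; rewrite gt_eqF.
  rewrite ler_pdivrMr ?exprn_gt0 //.
  have : z <= z ^+ 5 by rewrite -[leLHS]expr1 ler_weXn2l //; nra.
  nra.
have SS : z ^+ 2 <= lam * S.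
  apply: (@le_trans _ _ (lam * z ^+ 9)); last by rewrite ler_wpM2l // ltW.
  have -> : lam * z ^+ 9 = lam * z ^+ 7 * z ^+ 2 by ring.
  by rewrite lz7 mul1r.
have DD : (lam * D) ^+ 2 * mm <= 20 * K ^+ 2 * z.
  apply: (@le_trans _ _ ((K * (lam * z ^+ 2)) ^+ 2 * (20 * z ^+ 11))).
    have lD0 : 0 <= lam * D by rewrite mulr_ge0 // ltW.
    apply: ler_pM => //; first exact: exprn_ge0.
    by rewrite lerXn2r ?nnegrE // (le_trans lD0).
  rewrite le_eqVlt; apply/orP; left; apply/eqP.
  transitivity (20 * K ^+ 2 * z * (lam * z ^+ 7) ^+ 2); first by ring.
  by rewrite lz7 expr1n mulr1.
apply: (@le_trans _ _ (expR (- (4 + 10 * z)))).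
  rewrite ler_expR; rewrite -mulrA in DD *; nra.
rewrite expRN lef_pV2 ?posrE ?expR_gt0 ?mulr_gt0 -?zN ?exprn_gt0 // expRD.
apply: ler_pM; rewrite ?exprn_ge0 ?(ltW z0) //.
  by have := expR_ge1Dx (4 : R); lra.
rewrite expRM_natl lerXn2r ?nnegrE ?expR_ge0 ?(ltW z0) //.
by have := expR_ge1Dx z; lra.
Qed.

(** * Some vertex is uncovered after a small multiple of R_2 n balls *)

Section NotCovered.
Variables (R : realType) (V : finType) (e : rel V) (Delta Q m : nat).
Variables (d : measure_display) (T : measurableType d) (P : probability T R).
Variables (B : nat -> T -> trajectory V).
Local Notation n := #|V|.
Local Notation r := (R2 R e).
Let K : nat := (20 * Delta.+1 + Q ^ 2)%N.
(* z = n^(1/10) *)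
Let z : R := expR (ln n%:R / 10).
Hypothesis syme : symmetric e.
Hypothesis degD : (max_degree e <= Delta)%N.
Hypothesis vt : vertex_transitive e.
Hypothesis lsa : local_search_allocation e P B.
Hypothesis QD : (16 * Delta.+1 <= Q)%N.
Hypothesis mr : (m * (4 * Q ^ 80) <= r * n)%N.
Hypothesis nK : ((80 * K ^ 2 + 28) ^ 10 <= n)%N.
Hypothesis nD : (4 ^ Delta.+1 < n)%N.

Let V0 : (0 < n)%N.
Proof. by apply: leq_ltn_trans nD. Qed.

Let n0 : 0 < n%:R :> R.
Proof. by rewrite ltr0n. Qed.

Let zn : z ^+ 10 = n%:R.
Proof. by rewrite /z -expRM_natr divfK // lnK // posrE. Qed.

Let zK : 80 * K%:R ^+ 2 + 28 <= z.
Proof.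
rewrite -(@ler_pXn2r _ 10) ?nnegrE ?expR_ge0 ?addr_ge0 ?mulr_ge0 ?exprn_ge0 //.
by rewrite zn -[X in X <= _]/(_ ^+ 10); rewrite -natrX -natrM -natrD -natrX ler_nat.
Qed.

Let K20 : 20 * Delta.+1%:R <= K%:R :> R.
Proof. by rewrite -natrM ler_nat leq_addr. Qed.

Let D1 : 1 <= Delta.+1%:R :> R.
Proof. by rewrite ler1n. Qed.

Let K1 : 1 <= K%:R :> R.
Proof. by have := K20; have := D1; lra. Qed.

Let z1 : 1 <= z.
Proof. by have := zK; have := K1; nra. Qed.

Let ln_le_z : ln n%:R <= 10 * z.
Proof. by have := expR_ge1Dx (ln n%:R / 10 : R); rewrite -/z; lra. Qed.

Let r2 : (1 < r)%N.
Proof.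
apply: R2_gt1 degD V0 _; rewrite -ltr_expR lnK ?posrE //.
apply: (@le_lt_trans _ _ (4 ^ Delta.+1)%:R); last by rewrite ltr_nat.
rewrite -[X in expR X]mulr1 expRM_natl natrX lerXn2r ?nnegrE ?expR_ge0 //.
have -> : 1 = 1 / 2 + 1 / 2 :> R by lra.
rewrite expRD; have := expR_half_le2 R; have := expR_ge0 (1 / 2 : R); nra.
Qed.

Let r0 : (0 < r)%N.
Proof. by apply: ltn_trans r2. Qed.

Let Qr16 : 16 * Delta.+1%:R <= Q%:R :> R.
Proof. by rewrite -natrM ler_nat. Qed.

Let Q1 : (1 < Q)%N.
Proof. by apply: leq_trans QD; rewrite mulnS. Qed.

(** The form in which the smallness of m is used, with x = Q^80 for the maximal load, 10 (Delta + 1)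
    for nearby births, Q^2 for the growth of the excess, and 1 for m itself. *)
Let mn (x : R) : 0 <= x -> x <= Q%:R ^+ 80 -> 4 * x / n%:R * m%:R <= r%:R.
Proof.
move=> x0 xQ; rewrite mulrAC ler_pdivrMr // -natrM.
apply: (@le_trans _ _ (m * (4 * Q ^ 80))%:R); last by rewrite ler_nat.
rewrite (natrM _ m) (natrM _ 4) natrX [leLHS]mulrC !ler_wpM2l //.
Qed.

Let r_le : r%:R <= 2 * ln n%:R :> R.
Proof. exact: R2_le_ln vt V0 r2. Qed.

Let b v : nat := #|gball R e v r|.

Let b_ln v : r%:R * (b v)%:R <= 2 * Delta.+1%:R * ln n%:R :> R.
Proof. by rewrite -natrM; exact: R2_card_gball. Qed.

Let b_le v : (b v)%:R <= 20 * Delta.+1%:R * z.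
Proof.
have := b_ln v; have := ln_le_z; have := D1; have : 1 <= r%:R :> R by rewrite ler1n.
have : 0 <= (b v)%:R :> R by [].
nra.
Qed.

(* The largest L with Q ^ (80 L) <= n^4: then Q ^ (2 L) <= n^(1/10), whereas  *)
(* the maximal load exceeds L with probability at most n^-2.                   *)
Let L : nat := trunc_log (Q ^ 80) (n ^ 4).

Let QL : Q%:R ^+ (2 * L) <= z.
Proof.
rewrite -(@ler_pXn2r _ 40) ?nnegrE ?expR_ge0 ?exprn_ge0 //.
rewrite (exprM z 10 4) zn -exprM (_ : (2 * L * 40 = 80 * L)%N); last by rewrite mulnAC.
rewrite exprM -!natrX ler_nat; apply: trunc_logP; last by rewrite expn_gt0 V0.
by rewrite -[X in (X < _)%N](exp1n 80) ltn_exp2r.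
Qed.

Let n4 : 4 <= n%:R :> R.
Proof. by rewrite ler_nat; apply: leq_trans (ltnW nD); rewrite expnS leq_pmulr ?expn_gt0. Qed.

Lemma max_load_tail :
  (P [set w | exists v, (L < load (B ^~ w) m v)%N] <= (4 * n%:R)^-1%:E)%E.
Proof.
have M1 : 1 <= Q%:R ^+ 80 :> R by rewrite exprn_ege1 // ler1n ltnW.
apply: le_trans (local_search_max_load_le m L V0 lsa M1) _; rewrite lee_fin.
have M0 : 0 < Q%:R ^+ 80 :> R by exact: lt_le_trans M1.
have ML : n%:R ^+ 4 <= (Q%:R ^+ 80) ^+ L.+1 :> R.
  rewrite -!natrX ler_nat ltnW //; apply: trunc_log_ltn.
  by rewrite -[X in (X < _)%N](exp1n 80) ltn_exp2r.
have cm : (1 + Q%:R ^+ 80 / n%:R) ^+ m <= n%:R :> R.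
  apply: le_trans (expr1D_le_expR _ _) _; first by rewrite divr_ge0 // ltW.
  rewrite -[leRHS]lnK ?posrE // ler_expR.
  have := mn (ltW M0) (lexx _); have := r_le; rewrite -(mulrA 4) -(mulrA 4).
  have : 0 <= ln n%:R :> R by rewrite ln_ge0 // (le_trans _ n4) // ler1n.
  lra.
rewrite ler_pdivrMr ?(exprn_gt0 _ M0) //.
apply: (@le_trans _ _ (n%:R * n%:R)); first by rewrite ler_wpM2l.
have i0 : 0 <= (4 * n%:R)^-1 :> R by rewrite invr_ge0 mulr_ge0.
apply: le_trans (ler_wpM2l i0 ML).
rewrite ler_pdivlMl ?mulr_gt0 // -mulrA -expr2 -exprS exprS.
by rewrite ler_wpM2r // exprn_ge0.
Qed.

Lemma bounded_cover_tail :
  (P [set w | forall v, (0 < load (B ^~ w) m v <= L)%N] <= (4 * n%:R)^-1%:E)%E.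
Proof.
have [v0 _] := card_gt0P V0.
have bE v : #|gball R e v r| = b v0 by exact: vertex_transitive_card_gball.
have HQ : 2 * Delta.+1%:R <= Q%:R :> R by have := Qr16; have := D1; lra.
have Q80 : Q%:R <= Q%:R ^+ 80 :> R by rewrite -[leLHS]expr1 ler_weXn2l // ler1n ltnW.
have Q1r : 1 <= Q%:R :> R by rewrite ler1n ltnW.
pose bn : R := (b v0)%:R / n%:R.
have bn0 : 0 <= bn by rewrite divr_ge0.
have bn_half : bn <= 1 / 2.
  rewrite ler_pdivrMr // -zn; have bz := b_le v0.
  have zz : z ^+ 2 <= z ^+ 10 by rewrite ler_weXn2l.
  have z0 : 0 <= z by exact: expR_ge0.
  have K2 : 2 * K%:R <= z by have := zK; have := K1; nra.
  have bK : (b v0)%:R <= K%:R * z by apply: le_trans bz _; rewrite ler_wpM2r.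
  have : 2 * K%:R * z <= z ^+ 2 by rewrite expr2 ler_wpM2r.
  lra.
have bnm : bn * m%:R <= ln n%:R / 20.
  have xQ : 10 * Delta.+1%:R <= Q%:R ^+ 80 :> R.
    by have := Qr16; have := D1; lra.
  have x0 : 0 <= 10 * Delta.+1%:R :> R by rewrite mulr_ge0.
  have := mn x0 xQ; have := b_ln v0.
  have -> : 4 * (10 * Delta.+1%:R) / n%:R * m%:R = 40 * Delta.+1%:R * (m%:R / n%:R) :> R by ring.
  have -> : bn * m%:R = (b v0)%:R * (m%:R / n%:R) by rewrite /bn; ring.
  move=> br mr'.
  have : (b v0)%:R * (40 * Delta.+1%:R * (m%:R / n%:R)) <= 2 * Delta.+1%:R * ln n%:R :> R.
    by apply: le_trans br; rewrite mulrC ler_wpM2r.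
  have D0 : 0 < Delta.+1%:R :> R by rewrite ltr0n.
  move: D0; move: (m%:R / n%:R) (ln n%:R) (b v0)%:R (Delta.+1%:R) => q l c D D0 Hc.
  suff : D * (c * q) <= D * (l / 20) by rewrite ler_pM2l.
  have -> : D * (c * q) = c * (40 * D * q) / 40 by field.
  have -> : D * (l / 20) = 2 * D * l / 40 by field.
  by rewrite ler_pM2r // invr_gt0.
pose p : R := 1 - bn.
have p2 : 1 / 2 <= p by rewrite /p; lra.
(* 1 - x >= exp(-2x) on [0, 1/2], and 2 m b / n <= log n / 10, so a given vertex avoids nearby
   births with probability at least n^(-1/10). *)
have pm : z^-1 <= p ^+ m.
  apply: (@le_trans _ _ (expR (- (2 * bn)) ^+ m)); last first.
    by rewrite lerXn2r ?nnegrE ?expR_ge0 ?expRN2_le //; lra.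
  rewrite -expRM_natr /z -expRN ler_expR; lra.
(* The growth of the excess is at most exp(r/2) <= 2^r, and 6 * 2^r <= 16^r <= Q^r. *)
have am : 6 * (1 + 2 * Q%:R ^+ 2 / n%:R) ^+ m <= Q%:R ^+ r :> R.
  apply: (@le_trans _ _ (6 * 2 ^+ r)).
    rewrite ler_wpM2l //; apply: le_trans (expr1D_le_expR _ _) _.
      by rewrite divr_ge0 ?mulr_ge0 ?exprn_ge0.
    apply: (@le_trans _ _ (expR (1 / 2 * r%:R))).
      rewrite ler_expR; have x0 : 0 <= Q%:R ^+ 2 :> R by rewrite exprn_ge0.
      have xQ : Q%:R ^+ 2 <= Q%:R ^+ 80 :> R by rewrite ler_weXn2l.
      by have := mn x0 xQ; rewrite -!(mulrA 4) -!(mulrA 2); lra.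
    by rewrite expRM_natr lerXn2r ?nnegrE ?expR_ge0 ?expR_half_le2.
  apply: (@le_trans _ _ (16 ^+ r)); last first.
    by rewrite lerXn2r ?nnegrE //; have := Qr16; have := D1; lra.
  rewrite -natrX -natrX -natrM ler_nat (_ : 16 = 8 * 2)%N // expnMn leq_mul2r.
  by apply/orP; right; rewrite -(prednK r0) expnS (@leq_trans 8) // leq_pmulr ?expn_gt0.
pose D : R := ((b v0)%:R + Q%:R ^+ 2) * Q%:R ^+ (2 * L).
have D0 : 0 <= D by rewrite mulr_ge0 ?addr_ge0 ?exprn_ge0.
have DK : D <= K%:R * z ^+ 2.
  rewrite expr2 mulrA; apply: ler_pM; rewrite ?addr_ge0 ?exprn_ge0 ?QL //.
  have -> : K%:R = 20 * Delta.+1%:R + Q%:R ^+ 2 :> R by rewrite natrD natrM natrX.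
  rewrite mulrDl lerD ?b_le // ler_peMr ?exprn_ge0 ?z1 //.
have Sz : z ^+ 9 <= n%:R * p ^+ m.
  apply: (@le_trans _ _ (n%:R * z^-1)); last by rewrite ler_wpM2l.
  by rewrite -zn [z ^+ 10]exprSr mulfK // gt_eqF ?expR_gt0.
have mz : m%:R <= 20 * z ^+ 11.
  have xQ : 1 <= Q%:R ^+ 80 :> R by exact: le_trans Q80.
  have := mn ler01 xQ; rewrite mulr1 mulrAC ler_pdivrMr // => m4.
  apply: (@le_trans _ _ (r%:R * n%:R)); first by apply: le_trans m4; rewrite ler_peMl // ler1n.
  have -> : 20 * z ^+ 11 = 20 * z * z ^+ 10 by ring.
  rewrite -zn; apply: ler_wpM2r; first by rewrite exprn_ge0 ?expR_ge0.
  apply: le_trans r_le _; have -> : 20 * z = 2 * (10 * z) by rewrite mulrA -natrM.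
  by rewrite ler_wpM2l // ln_le_z.
have [lamD fin] := azuma_exponent K1 zK zn Sz D0 DK (ler0n _ _) mz.
have lam0 : 0 <= (z ^+ 7)^-1 by rewrite invr_ge0 exprn_ge0 // expR_ge0.
have := @local_search_cover_le R V e Q%:R Delta r (b v0) L syme degD HQ bE d T P B m _
  lsa V0 p2 am lam0 lamD.
move=> /le_trans; apply; rewrite lee_fin.
exact: fin.
Qed.

Lemma local_search_not_covered :
  (P [set w | forall v, (0 < load (B ^~ w) m v)%N] <= (2 * n%:R)^-1%:E)%E.
Proof.
have mA (A : set (nat -> trajectory V)) : determined m A ->
    measurable [set w | A (B ^~ w)] by exact: (measurable_determined lsa).
have m1 : measurable [set w | forall v, (0 < load (B ^~ w) m v <= L)%N].
  apply: (mA [set h | forall v, (0 < load h m v <= L)%N]).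
  by move=> h h' hh' /=; rewrite (eq_load hh').
have m2 : measurable [set w | exists v, (L < load (B ^~ w) m v)%N].
  apply: (mA [set h | exists v, (L < load h m v)%N]).
  by move=> h h' hh' /=; rewrite (eq_load hh').
have m3 : measurable [set w | forall v, (0 < load (B ^~ w) m v)%N].
  apply: (mA [set h | forall v, (0 < load h m v)%N]).
  by move=> h h' hh' /=; rewrite (eq_load hh').
apply: (@le_trans _ _ (P ([set w | forall v, (0 < load (B ^~ w) m v <= L)%N] `|`
    [set w | exists v, (L < load (B ^~ w) m v)%N]))).
  rewrite le_measure ?inE //; first exact: measurableU.
  move=> w /= cov; have [big|nbig] := pselect (exists v, (L < load (B ^~ w) m v)%N).
    by right.
  left=> v; rewrite cov leqNgt; apply/negP => vL; apply: nbig; by exists v.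
apply: le_trans (measureU2 _ m1 m2) _.
apply: le_trans (leeD bounded_cover_tail max_load_tail) _.
rewrite -EFinD lee_fin le_eqVlt; apply/orP; left; apply/eqP; field.
by rewrite gt_eqF.
Qed.

End NotCovered.

(** * Union bound and the two-sided estimate *)

Lemma local_search_some_uncovered_le (R : realType) (V : finType) (e : rel V)
    (d : measure_display) (T : measurableType d) (P : probability T R)
    (B : nat -> T -> trajectory V) (Delta j : nat) (Q : R) :
  symmetric e -> (max_degree e <= Delta)%N -> local_search_allocation e P B ->
  2 * Delta.+1%:R <= Q -> expR 3 * Q ^+ 2 <= 2 ^+ j -> (128 <= #|V|)%N ->
  (P [set w | exists v, load (B ^~ w) (2 * j * R2 R e * #|V|) v = 0%N] <=
   (2 * #|V|%:R)^-1%:E)%E.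
Proof.
move=> syme degD lsa HQ Hj n128; set r := R2 R e; set n := #|V|.
have n0 : 0 < n%:R :> R by rewrite ltr0n; apply: leq_trans n128.
have nr : 128 <= n%:R :> R by rewrite ler_nat.
(* Since r |ball| >= log n, each vertex is uncovered with probability at most e^3 / n^3; then e^3 <=
   64 and n >= 128 absorb the constant. *)
apply: (@le_trans _ _ (n%:R * (expR 3 / n%:R ^+ 3))%:E).
  apply: (@measure_exists_le _ _ _ P V
    (fun v => [set w | load (B ^~ w) (2 * j * r * n) v = 0%N])) => v.
    apply: (measurable_determined lsa
      (A := [set h | load h (2 * j * r * n) v = 0%N]) (m := 2 * j * r * n)).
    by move=> h h' hh' /=; rewrite (eq_load hh').
  apply: le_trans (local_search_uncovered_le r v syme degD lsa HQ Hj) _.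
  rewrite lee_fin ler_pM2l ?expR_gt0 // lef_pV2 ?posrE ?exprn_gt0 ?expR_gt0 //.
  rewrite -[X in X ^+ 3 <= _]lnK ?posrE // -!expRM_natl ler_expR.
  by rewrite mulrC ler_wpM2r // natrM R2_ge.
have e6 : expR 3 <= 64 :> R.
  have -> : 3 = 6%:R * (1 / 2) :> R by lra.
  rewrite expRM_natl; apply: (@le_trans _ _ (2 ^+ 6)); last by rewrite -natrX ler_nat.
  by rewrite lerXn2r ?nnegrE ?expR_ge0 // expR_half_le2.
rewrite lee_fin -[leRHS]div1r ler_pdivlMr ?mulr_gt0 //.
have -> : n%:R * (expR 3 / n%:R ^+ 3) * (2 * n%:R) = 2 * expR 3 / n%:R :> R.
  by field; rewrite gt_eqF.
rewrite ler_pdivrMr // mul1r; lra.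
Qed.

Theorem theorem1p3 (R : realType) (Delta : nat) :
  exists (c C : R) (n0 : nat), 0 < c /\ 0 < C /\
    forall (V : finType) (e : rel V),
      simple_graph e -> vertex_transitive e -> (max_degree e <= Delta)%N ->
      (n0 <= #|V|)%N ->
      forall (d : measure_display) (T : measurableType d)
             (P : probability T R) (B : nat -> T -> trajectory V),
        local_search_allocation e P B ->
        (P [set w | ((c * (R2 R e)%:R * #|V|%:R)%:E <= cover_time R B w)%E /\
                    (cover_time R B w <= (C * (R2 R e)%:R * #|V|%:R)%:E)%E]
         >= (1 - #|V|%:R^-1)%:E)%E.
Proof.
pose Q : nat := (16 * Delta.+1)%N.
have [Z ZE] : exists Z : nat, Z = (4 * Q ^ 80)%N by exists (4 * Q ^ 80)%N.
pose K : nat := (20 * Delta.+1 + Q ^ 2)%N.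
pose j : nat := (Num.bound (expR 3 * Q%:R ^+ 2 : R)).+1.
have Zgt0 : (0 < Z)%N by rewrite ZE muln_gt0 expn_gt0.
have Z0 : 0 < Z%:R :> R by rewrite ltr0n.
have Hj : expR 3 * Q%:R ^+ 2 <= 2 ^+ j :> R.
  have E0 : 0 <= expR 3 * Q%:R ^+ 2 :> R by rewrite mulr_ge0 ?expR_ge0 ?exprn_ge0.
  apply: le_trans (ltW (archi_boundP E0)) _; rewrite -(natrX _ 2) ler_nat.
  by apply: leq_trans (ltnW (ltn_expl _ (isT : 1 < 2)%N)) _; rewrite leq_exp2l.
(* c = 1/(4 Q^80) is the smallness of m required by the lower bound, C = 2j the number of balls per
   R_2 n in the upper bound, and n_0 makes n^(1/10) large and log n > Delta + 1, so that R_2 >=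
   2. *)
exists Z%:R^-1, (2 * j)%:R, ((80 * K ^ 2 + 28) ^ 10 + 4 ^ Delta.+1 + 1)%N.
split; first by rewrite invr_gt0.
split; first by rewrite ltr0n muln_gt0.
move=> V e [syme _] vt degD nV d T P B lsa.
have nK : ((80 * K ^ 2 + 28) ^ 10 <= #|V|)%N.
  by apply: leq_trans nV; rewrite -addnA leq_addr.
have nD : (4 ^ Delta.+1 < #|V|)%N.
  by apply: leq_trans nV; rewrite addn1 ltnS leq_addl.
have n128 : (128 <= #|V|)%N.
  apply: leq_trans nK; apply: (@leq_trans (28 ^ 2)) => //.
  by apply: (@leq_trans (28 ^ 10)); [rewrite leq_exp2l|rewrite leq_exp2r // leq_addl].
have n0 : 0 < #|V|%:R :> R by rewrite ltr0n; apply: leq_trans n128.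
set r := R2 R e; set n := #|V|.
pose m1 := ((r * n) %/ Z)%N; pose m2 := (2 * j * r * n)%N.
pose y : R := Z%:R^-1 * r%:R * n%:R.
pose cov (h : nat -> trajectory V) k := forall v, (1 <= load h k v)%N.
pose A := [set h : nat -> trajectory V |
  (y%:E <= nat_inf R [set k | cov h k])%E /\
  (nat_inf R [set k | cov h k] <= ((2 * j)%:R * r%:R * n%:R)%:E)%E].
have upE : (2 * j)%:R * r%:R * n%:R = m2%:R :> R by rewrite /m2 !natrM.
have y_m1 k : k%:R < y -> (k <= m1)%N.
  rewrite /y -mulrA ltr_pdivlMl // -!natrM ltr_nat => kr.
  by rewrite leq_divRL // mulnC ltnW.
have cov_mono h k l : (k <= l)%N -> cov h k -> cov h l.
  by move=> kl ck v; apply: leq_trans (load_mono h v kl); exact: ck.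
have eq_cov h h' k l : (forall i, (i < l)%N -> h i = h' i) -> (k <= l)%N ->
    cov h k -> cov h' k.
  move=> hh kl ck v; have <- : load h k = load h' k; last exact: ck.
  by apply: eq_load => i ik; rewrite hh // (leq_trans ik).
(* The lower bound can fail only through covering at some time at most m1, and the upper bound is
   decided by time m2, so the event is measurable. *)
have detA : determined (maxn m1 m2) A.
  move=> h h' hh /= [lo up]; split.
    apply/nat_inf_ge => k ck; rewrite leNgt; apply/negP => ky.
    move/nat_inf_ge: lo => /(_ k); rewrite leNgt ky => lo; suff : false by [].
    apply: lo; apply: (eq_cov h' h k (maxn m1 m2)) ck => [i im|].
      by rewrite hh.
    by rewrite leq_max y_m1.
  move: up; rewrite upE => /nat_inf_le[k ck km]; apply/nat_inf_le; exists k => //.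
  by apply: (eq_cov h h' k (maxn m1 m2)) ck => //; rewrite leq_max km orbT.
have mE A' m : determined m A' -> measurable [set w | A' (B ^~ w)].
  exact: (measurable_determined lsa).
pose E1 := [set w | forall v, (0 < load (B ^~ w) m1 v)%N].
pose E2 := [set w | exists v, load (B ^~ w) m2 v = 0%N].
have mE1 : measurable E1.
  apply: (mE [set h | forall v, (0 < load h m1 v)%N] m1).
  by move=> h h' hh' /=; rewrite (eq_load hh').
have mE2 : measurable E2.
  apply: (mE [set h | exists v, load h m2 v = 0%N] m2).
  by move=> h h' hh' /=; rewrite (eq_load hh').
have P1 : (P E1 <= (2 * n%:R)^-1%:E)%E.
  by apply: (@local_search_not_covered _ _ _ _ Q) nK nD => //; rewrite -ZE leq_divM.
have P2 : (P E2 <= (2 * n%:R)^-1%:E)%E.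
  apply: local_search_some_uncovered_le syme degD lsa _ Hj n128.
  by rewrite -natrM ler_nat leq_mul2r orbT.
have mU : measurable (E1 `|` E2) by exact: measurableU.
apply: (@le_trans _ _ (P (~` (E1 `|` E2)))); last first.
  apply: le_measure; rewrite ?inE; [exact: measurableC|exact: mE detA|].
  move=> w /not_orP[/= notE1 notE2]; split.
    apply/nat_inf_ge => k ck; rewrite leNgt; apply/negP => ky.
    by apply: notE1; exact: cov_mono (y_m1 _ ky) ck.
  rewrite upE; apply/nat_inf_le; exists m2 => // v.
  by rewrite lt0n; apply/eqP => v0; apply: notE2; exists v.
rewrite probability_setC // EFinB leeB //.
apply: le_trans (measureU2 _ mE1 mE2) _; apply: le_trans (leeD P1 P2) _.
rewrite -EFinD lee_fin le_eqVlt; apply/orP; left; apply/eqP; field.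
by rewrite gt_eqF.
Qed.
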